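(* Let $d\ge 1$, $m\ge 3$ be integers, $1\le k\le d$, and $s_c=\frac d2-\frac1{m-1}$. Consider the equation $(i\partial_t+\Delta)u=\partial_k(\overline{u}^{\,m})$ on $\mathbb{R}^d$ with $u(0)=u_0$. (i) Let $r>0$ be the radius for small-data global well-posedness in $\dot H^{s_c}$, and $S_\pm$ the corresponding flow maps on $B_r(\dot H^{s_c})$ (as described in the context). For every $u_0\in B_r(\dot H^{s_c})$ there exist $u_\pm\in\dot H^{s_c}$ such that $$S_\pm(u_0)(t)-e^{it\Delta}u_\pm\to0\quad\text{in }\dot H^{s_c}\text{ as }t\to\pm\infty.$$ (ii) The statement in (i) remains valid with $\dot H^{s_c}$ replaced by $H^s$ for $s\ge s_c$: let $r>0$ be the radius for small-data global well-posedness in $H^s$, and $S_\pm$ the corresponding flow maps on $B_r(H^s)$. For every $u_0\in B_r(H^s)$ there exist $u_\pm\in H^s$ such that $S_\pm(u_0)(t)-e^{it\Delta}u_\pm\to0$ in $H^s$ as $t\to\pm\infty$.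
   Context: **Small-data well-posedness and flow maps.** In (i), $r>0$ is a number such that for every $u_0\in B_r(\dot H^{s_c})$ there is a unique solution $u\in\dot Z^{s_c}_r([0,\infty))$ on $(0,\infty)$, and $S_+:B_r(\dot H^{s_c})\to\dot Z^{s_c}([0,\infty))$, $u_0\mapsto u$, is Lipschitz continuous (the paper's well-posedness theorem asserts that such $r$ exists). In (ii), $r$ and $S_+$ are the same with $\dot H^{s_c},\dot Z^{s_c}_r,\dot Z^{s_c}$ replaced by $H^s,Z^s_r,Z^s$. $S_-$ is the flow map for $t\in(-\infty,0)$ obtained by time reversibility (if $u(t,x)$ solves the equation, so does $\overline{u(-t,x)}$): $S_-(u_0)(t)=\overline{S_+(\overline{u_0})(-t)}$ for $t\le0$. **Solutions.** Solution means solution of the Duhamel equation $u(t)=e^{it\Delta}u_0-i\int_0^t e^{i(t-t')\Delta}\partial_k(\overline{u(t')}^{\,m})\,dt'$, where $\partial_k=\partial/\partial x_k$ and $\mathcal F_x[e^{it\Delta}f](\xi)=e^{-it|\xi|^2}\widehat f(\xi)$. For a Banach space $H$ and $r>0$, $B_r(H)=\{f\in H:\|f\|_H\le r\}$. **Frequency projections.** Capital letters $N$ denote dyadic numbers $2^n$, $n\in\mathbb{Z}$, and $\sum_N$ is the sum over all of them. Fix an even non-negative $\chi\in C_0^\infty((-2,2))$ with $\chi(t)=1$ for $|t|\le1$; $\psi(t)=\chi(t)-\chi(2t)$, $\psi_N(t)=\psi(N^{-1}t)$, and $\widehat{P_Nu}(\xi)=\psi_N(|\xi|)\widehat u(\xi)$.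 **Sobolev norms.** For $s\ge0$, $\|f\|_{\dot H^s}=\left(\sum_N N^{2s}\|P_Nf\|_{L^2}^2\right)^{1/2}$ and $\|f\|_{H^s}=\|f\|_{\dot H^0}+\|f\|_{\dot H^s}$ (equivalent to the usual norms). **$U^2$.** Let $\mathcal Z$ be the set of finite partitions $\{t_k\}_{k=0}^K$, $K\in\mathbb{N}$, $-\infty<t_0<t_1<\dots<t_K\le\infty$. For $1\le p<\infty$, a $U^p$-atom is a function $a:\mathbb{R}\to L^2(\mathbb{R}^d)$, $a(t)=\sum_{k=1}^K\mathbf 1_{[t_{k-1},t_k)}(t)\phi_{k-1}$ with $\{t_k\}\in\mathcal Z$, $\phi_k\in L^2$, $\sum_{k=0}^{K-1}\|\phi_k\|_{L^2}^p=1$. $U^p$ is the space of $u=\sum_{j\ge1}\lambda_ja_j$ with $a_j$ $U^p$-atoms, $\lambda_j\in\mathbb{C}$ and $\sum_j|\lambda_j|<\infty$, normed by $\|u\|_{U^p}=\inf\sum_j|\lambda_j|$ over all such representations. $U^p_\Delta=\{u:\mathbb{R}\to L^2:\ e^{-it\Delta}u\in U^p\}$ with $\|u\|_{U^p_\Delta}=\|e^{-it\Delta}u\|_{U^p}$. **Solution spaces.** $\dot Z^s=\{u\in C(\mathbb{R};\dot H^s(\mathbb{R}^d))\cap U^2_\Delta:\ \|u\|_{\dot Z^s}<\infty\}$ with $\|u\|_{\dot Z^s}:=\left(\sum_NN^{2s}\|P_Nu\|_{U^2_\Delta}^2\right)^{1/2}$. $Z^s=\{u\in C(\mathbb{R};H^s(\mathbb{R}^d))\cap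 U^2_\Delta:\ \|u\|_{Z^s}<\infty\}$ with $\|u\|_{Z^s}:=\|u\|_{\dot Z^0}+\|u\|_{\dot Z^s}$. **Restriction to intervals.** For a Banach space $E$ of continuous functions $\mathbb{R}\to H$ ($H$ a Hilbert space) and an interval $I\subset\mathbb{R}$, $E(I)=\{u\in C(I,H):\ \exists v\in E,\ v=u\text{ on }I\}$ with $\|u\|_{E(I)}=\inf\{\|v\|_E: v\in E,\ v=u\text{ on }I\}$. **Balls.** $\dot Z^s_r(I)=\{u\in\dot Z^s(I):\|u\|_{\dot Z^s(I)}\le2r\}$ and $Z^s_r(I)=\{u\in Z^s(I):\|u\|_{Z^s(I)}\le2r\}$.
   Formalization: The homogeneous space Ḣ^{s_c} is taken to be the L² functions with finite Ḣ^{s_c} norm, since solutions in Ż^{s_c} ⊂ U²_Δ are L²-valued, so for data outside L² the flow map as described does not exist; u_± are then also in L². *)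

(* Defs.v *)
From HB Require Import structures.
From mathcomp Require Import all_boot all_order all_algebra.
From mathcomp Require Import all_classical all_reals all_analysis.
From mathcomp Require Import complex.

Set Implicit Arguments.
Unset Strict Implicit.
Unset Printing Implicit Defensive.

Import Order.TTheory GRing.Theory Num.Theory.
Import numFieldNormedType.Exports.

Local Open Scope classical_set_scope.
Local Open Scope ring_scope.

(* R^d is d.-tuple R with its product sigma-algebra (here, the Borel sets).
   Lebesgue measure on R^(n+1) is the image of the product of the Lebesgue
   measures of R and R^n under (x, t) |-> x :: t. *)
Section LebesgueTuple.
Context {R : realType}.
Local Notation mR := (measurableTypeR R).

Definition tcons n (p : mR * n.-tuple mR) : n.+1.-tuple mR :=
  [tuple of p.1 :: p.2].

Definition tuncons n (t : n.+1.-tuple mR) : mR * n.-tuple mR :=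
  (thead t, [tuple of behead t]).

Lemma tconsK n : cancel (@tcons n) (@tuncons n).
Proof.
by case=> x t; rewrite /tuncons /tcons /=; congr (_, _); exact/val_inj.
Qed.

Lemma tunconsK n : cancel (@tuncons n) (@tcons n).
Proof. by move=> t; rewrite /tcons /tuncons /= [in RHS](tuple_eta t). Qed.

Lemma measurable_tcons n : measurable_fun [set: mR * n.-tuple mR] (@tcons n).
Proof. exact: measurable_cons. Qed.

Lemma measurable_tuncons n : measurable_fun [set: n.+1.-tuple mR] (@tuncons n).
Proof.
by apply: measurable_fun_pair; [exact: measurable_tnth|exact: measurable_behead].
Qed.

Section step.
Variables (n : nat) (mu : {sigma_finite_measure set (n.-tuple mR) -> \bar R}).

Definition lebesgue_step : set (n.+1.-tuple mR) -> \bar R :=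
  pushforward (@lebesgue_measure R \x mu)%E (@tcons n).

Let step0 : lebesgue_step set0 = 0%E.
Proof. by rewrite /lebesgue_step /pushforward preimage_set0 measure0. Qed.

Let step_ge0 A : (0 <= lebesgue_step A)%E.
Proof. by apply: integral_ge0 => x _; exact: measure_ge0. Qed.

Let step_sigma_additive : semi_sigma_additive lebesgue_step.
Proof.
move=> F mF tF mUF; rewrite /lebesgue_step /pushforward preimage_bigcup.
have mT A : measurable A -> measurable (@tcons n @^-1` A).
  by move=> mA; rewrite -[X in measurable X]setTI; exact: measurable_tcons.
apply: measure_semi_sigma_additive.
- by move=> i; exact: mT.
- apply/trivIsetP => /= i j _ _ ij; rewrite -preimage_setI.
  by move/trivIsetP : tF => /(_ _ _ _ _ ij) ->//; rewrite preimage_set0.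
- by rewrite -preimage_bigcup; exact: mT.
Qed.

HB.instance Definition _ := isMeasure.Build _ _ _ lebesgue_step
  step0 step_ge0 step_sigma_additive.

Let step_sigma_finite : sigma_finite setT lebesgue_step.
Proof.
have /sigma_finiteP[F [TF ndF Foo]] := sigma_finiteT (@lebesgue_measure R).
have /sigma_finiteP[G [TG ndG Goo]] := sigma_finiteT mu.
exists (fun i => @tuncons n @^-1` (F i `*` G i)) => [|i].
  rewrite -preimage_bigcup (_ : \bigcup_i _ = setT) ?preimage_setT//.
  rewrite -subTset => -[x y] _.
  have [i _ Fx] : (\bigcup_i F i) x by rewrite -TF.
  have [j _ Gy] : (\bigcup_i G i) y by rewrite -TG.
  exists (maxn i j) => //; split => /=.
    by move: x Fx; exact/subsetPset/ndF/leq_maxl.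
  by move: y Gy; exact/subsetPset/ndG/leq_maxr.
have [mF Fi] := Foo i; have [mG Gi] := Goo i; split.
  rewrite -[X in measurable X]setTI; apply: measurable_tuncons => //.
  exact: measurableX.
rewrite /lebesgue_step /pushforward -comp_preimage.
rewrite (_ : _ \o _ = id); last by apply/funext => p /=; rewrite tconsK.
rewrite preimage_id product_measure1E// lte_mul_pinfty// ge0_fin_numE//.
Qed.

HB.instance Definition _ := Measure_isSigmaFinite.Build _ _ _ lebesgue_step
  step_sigma_finite.

End step.

Fixpoint lebesgue_tuple (n : nat) :
    {sigma_finite_measure set (n.-tuple mR) -> \bar R} :=
  match n with
  | 0 => \d_([tuple] : 0.-tuple mR)
  | n'.+1 => lebesgue_step (lebesgue_tuple n')
  end.

End LebesgueTuple.
Arguments lebesgue_tuple {R} n.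

Section Euclidean.
Context {R : realType} {d : nat}.
Local Notation Rd := (d.-tuple (measurableTypeR R)).

Definition dotp (x y : Rd) : R := \sum_(i < d) tnth x i * tnth y i.

Definition enorm (x : Rd) : R := Num.sqrt (dotp x x).

Definition shift_coord (j : 'I_d) (h : R) (x : Rd) : Rd :=
  [tuple tnth x i + (if i == j then h else 0) | i < d].

Definition partial (j : 'I_d) (f : Rd -> R) : Rd -> R :=
  fun x => derive1 (fun h : R => f (shift_coord j h x)) 0.

(* Bounded partial derivatives of all orders are Lipschitz, so the existence
   of all iterated partial derivatives together with the decay bounds already
   implies smoothness. *)
Definition schwartz (phi : Rd -> R) : Prop :=
  (forall (js : seq 'I_d) (j : 'I_d) (x : Rd),
     derivable (fun h : R => foldr partial phi js (shift_coord j h x)) 0 1) /\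
  (forall (js : seq 'I_d) (n : nat), exists M : R, forall x : Rd,
     (1 + enorm x) ^+ n * `|foldr partial phi js x| <= M).

End Euclidean.

Section ComplexIntegral.
Context {R : realType} {disp : measure_display} {T : measurableType disp}.
Variables (mu : {measure set T -> \bar R}) (D : set T).

Definition cintegrable (f : T -> R[i]) : Prop :=
  mu.-integrable D (fun x => (complex.Re (f x))%:E) /\
  mu.-integrable D (fun x => (complex.Im (f x))%:E).

Definition cintegral (f : T -> R[i]) : R[i] :=
  ((\int[mu]_(x in D) complex.Re (f x))%R +i*
   (\int[mu]_(x in D) complex.Im (f x))%R)%C.

End ComplexIntegral.

Section L2.
Context {R : realType} {d : nat}.
Local Notation Rd := (d.-tuple (measurableTypeR R)).
Local Notation fct := (Rd -> R[i]).
Local Notation leb := (lebesgue_tuple d).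

(* Elements of L^2(R^d; C) are represented by functions; equality in L^2 is
   [aeeq]. *)
Definition aeeq (f g : fct) : Prop := \forall x \ae leb, f x = g x.

Definition L2norm (f : fct) : \bar R :=
  Lnorm leb 2%:E (fun x => (ComplexField.Normc.normc (f x))%:E).

Definition L2 (f : fct) : Prop :=
  [/\ measurable_fun setT (fun x => complex.Re (f x)),
      measurable_fun setT (fun x => complex.Im (f x)) &
      (L2norm f < +oo)%E].

Definition cis (theta : R) : R[i] := (cos theta +i* sin theta)%C.

Definition fourier_integral (f : fct) : fct := fun xi =>
  ((2 * pi) `^ (- (d%:R / 2)))%:C%C *
  cintegral leb setT (fun x => cis (- dotp x xi) * f x).

Definition fconj (f : fct) : fct := fun x => ((f x)^*)%C.

(* The unitary operator of L^2 (with its inverse) that is given by the Fourier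
   integral on the intersection of L^1 and L^2: by Plancherel's theorem it
   exists, and by density it is unique up to a.e. equality, so the default
   value of [xget] is never used. *)
Definition is_fourier (U : (fct -> fct) * (fct -> fct)) : Prop :=
  [/\ forall f, L2 f -> L2 (U.1 f) /\ L2 (U.2 f),
      forall f, L2 f -> L2norm (U.1 f) = L2norm f,
      forall (c : R[i]) f g, L2 f -> L2 g ->
        aeeq (U.1 (fun x => c * f x + g x)) (fun x => c * U.1 f x + U.1 g x),
      forall f, L2 f -> aeeq (U.2 (U.1 f)) f /\ aeeq (U.1 (U.2 f)) f &
      forall f, L2 f -> cintegrable leb setT f ->
        aeeq (U.1 f) (fourier_integral f)].

Definition fourier_pair : (fct -> fct) * (fct -> fct) :=
  xget (id : fct -> fct, id : fct -> fct) [set U | is_fourier U].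

Definition fourier : fct -> fct := fourier_pair.1.
Definition ifourier : fct -> fct := fourier_pair.2.

Definition schrodinger (t : R) (f : fct) : fct :=
  ifourier (fun xi => cis (- (t * enorm xi ^+ 2)) * fourier f xi).

End L2.

Section Up.
Context {R : realType} {d : nat}.
Local Notation Rd := (d.-tuple (measurableTypeR R)).
Local Notation fct := (Rd -> R[i]).
Local Open Scope ereal_scope.

(* A partition has extended real end points (only the last one can be +oo). *)
Definition U_atom (p : R) (a : R -> fct) : Prop :=
  exists (K : nat) (tk : nat -> \bar R) (phi : nat -> fct),
    [/\ -oo < tk 0%N,
        forall k, (k < K)%N -> tk k < tk k.+1,
        forall k, (k < K)%N -> L2 (phi k),
        \sum_(k < K) L2norm (phi k) `^ p = 1 &
        forall t x, a t x =
          (\sum_(k < K) if ((tk k <= t%:E) && (t%:E < tk k.+1))%E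
                        then phi k x else 0)%R].

(* u is the sum of lam_j a_j, pointwise in time with convergence in L^2. *)
Definition U_rep (p : R) (u : R -> fct) (lam : nat -> R[i])
    (a : nat -> R -> fct) : Prop :=
  [/\ forall j, U_atom p (a j),
      \sum_(0 <= j <oo) (ComplexField.Normc.normc (lam j))%:E < +oo &
      forall t, (fun n => L2norm (fun x =>
        (u t x - \sum_(j < n) lam j * a j t x)%R)) @ \oo --> 0].

Definition U_space (p : R) : set (R -> fct) :=
  [set u | (forall t, L2 (u t)) /\ exists lam a, U_rep p u lam a].

Definition U_norm (p : R) (u : R -> fct) : \bar R :=
  ereal_inf [set z | exists lam a, U_rep p u lam a /\
    z = \sum_(0 <= j <oo) (ComplexField.Normc.normc (lam j))%:E].

Definition free_pullback (u : R -> fct) : R -> fct :=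
  fun t => schrodinger (- t) (u t).

Definition UD_space (p : R) : set (R -> fct) :=
  [set u | U_space p (free_pullback u)].

Definition UD_norm (p : R) (u : R -> fct) : \bar R :=
  U_norm p (free_pullback u).

End Up.

Section Cutoff.
Context {R : realType}.

Definition is_cutoff (chi : R -> R) : Prop :=
  [/\ forall (n : nat) (t : R), derivable (derive1n n chi) t 1,
      closure [set t | chi t != 0] `<=` `]-2, 2[,
      forall t, chi (- t) = chi t,
      forall t, 0 <= chi t &
      forall t, `|t| <= 1 -> chi t = 1].

Definition psi (chi : R -> R) (t : R) : R := chi t - chi (2 * t).

Definition dyadic (n : int) : R := 2 ^ n.

End Cutoff.

(* A space H of functions on R^d is given by its norm hn: it consists of the
   L^2 functions with hn < +oo.  In particular the homogeneous space is taken
   inside L^2, as it must be for data of solutions in the homogeneous solution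
   space, whose elements belong to U^2_Delta and hence are L^2-valued. *)
Section FunctionSpaces.
Context {R : realType} {d : nat}.
Local Notation Rd := (d.-tuple (measurableTypeR R)).
Local Notation fct := (Rd -> R[i]).
Local Open Scope ereal_scope.

Section norms.
Variable chi : R -> R.

Definition LP (n : int) (f : fct) : fct :=
  ifourier (fun xi => ((psi chi ((dyadic n)^-1 * enorm xi))%:C%C
                       * fourier f xi)%R).

Definition Hdot_norm (s : R) (f : fct) : \bar R :=
  (\esum_(n in [set: int])
     ((dyadic n) `^ (2 * s))%:E * L2norm (LP n f) ^+ 2) `^ 2^-1.

Definition H_norm (s : R) (f : fct) : \bar R :=
  Hdot_norm 0 f + Hdot_norm s f.

Definition Zdot_norm (s : R) (u : R -> fct) : \bar R :=
  (\esum_(n in [set: int])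
     ((dyadic n) `^ (2 * s))%:E *
     UD_norm 2 (fun t => LP n (u t)) ^+ 2) `^ 2^-1.

Definition Z_norm (s : R) (u : R -> fct) : \bar R :=
  Zdot_norm 0 u + Zdot_norm s u.

End norms.

Variables (hn : fct -> \bar R) (zn : (R -> fct) -> \bar R).

Definition H_space : set fct := [set f | L2 f /\ hn f < +oo].

Definition H_ball (r : R) : set fct := [set f | H_space f /\ hn f <= r%:E].

Definition C_space (I : set R) : set (R -> fct) :=
  [set u | (forall t, I t -> H_space (u t)) /\
           forall t, I t ->
             hn (fun x => (u t' x - u t x)%R) @[t' --> within I (nbhs t)] --> 0].

Definition Z_space : set (R -> fct) :=
  [set u | [/\ C_space setT u, UD_space 2 u & zn u < +oo]].

Definition eq_on (I : set R) (u v : R -> fct) : Prop :=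
  forall t, I t -> aeeq (u t) (v t).

Definition Z_space_on (I : set R) : set (R -> fct) :=
  [set u | C_space I u /\ exists v, Z_space v /\ eq_on I v u].

Definition Z_norm_on (I : set R) (u : R -> fct) : \bar R :=
  ereal_inf [set zn v | v in [set v | Z_space v /\ eq_on I v u]].

Definition Z_ball_on (r : R) (I : set R) : set (R -> fct) :=
  [set u | Z_space_on I u /\ Z_norm_on I u <= (2 * r)%:E].

End FunctionSpaces.

Section Equation.
Context {R : realType} {d : nat}.
Local Notation Rd := (d.-tuple (measurableTypeR R)).
Local Notation fct := (Rd -> R[i]).
Local Notation leb := (lebesgue_tuple d).
Variables (m : nat) (k : 'I_d).

Definition pairing_integrand (f : fct) (phi : Rd -> R) : fct :=
  fun x => f x * (phi x)%:C%C.

Definition pairing (f : fct) (phi : Rd -> R) : R[i] :=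
  cintegral leb setT (pairing_integrand f phi).

Definition nonlin (f : fct) : fct := fun x => fconj f x ^+ m.

(* The distribution e^{i tau Delta} d_k G, applied to a test function phi, is
   - \int G e^{i tau Delta} (d_k phi): the propagator is symmetric for the
   bilinear pairing and commutes with d_k. *)
Definition propagated_integrand (tau : R) (G : fct) (phi : Rd -> R) : fct :=
  fun x => G x * schrodinger tau (fun y => (partial k phi y)%:C%C) x.

Definition propagated_pairing (tau : R) (G : fct) (phi : Rd -> R) : R[i] :=
  - cintegral leb setT (propagated_integrand tau G phi).

(* Duhamel equation on [0, +oo), in the sense of tempered distributions in
   space.  By linearity it is enough to test with real Schwartz functions.
   Since u(t')^m need be locally integrable only for a.e. t', the time
   integrand is given a.e. by an integrable function h. *)
Definition solution (u0 : fct) (u : R -> fct) : Prop :=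
  forall (t : R) (phi : Rd -> R), 0 <= t -> schwartz phi ->
  exists h : measurableTypeR R -> R[i],
    [/\ cintegrable (@lebesgue_measure R) `[0, t] h,
        \forall t' \ae (@lebesgue_measure R), `[0, t]%classic t' ->
          cintegrable leb setT
            (propagated_integrand (t - t') (nonlin (u t')) phi) /\
          h t' = propagated_pairing (t - t') (nonlin (u t')) phi &
        pairing (u t) phi =
          pairing (schrodinger t u0) phi
          - 'i%C * cintegral (@lebesgue_measure R) `[0, t] h].

Definition half_line : set R := `[0, +oo[.

(* r and S are a radius and a forward flow map for small-data global
   well-posedness in the space with norm hn, with solutions in the space with
   norm zn. *)
Definition well_posed (hn : fct -> \bar R) (zn : (R -> fct) -> \bar R)
    (r : R) (S : fct -> R -> fct) : Prop :=
  (forall u0, H_ball hn r u0 ->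
     [/\ Z_ball_on hn zn r half_line (S u0),
         solution u0 (S u0) &
         forall v, Z_ball_on hn zn r half_line v -> solution u0 v ->
           eq_on half_line v (S u0)]) /\
  (exists L : R, forall u0 v0, H_ball hn r u0 -> H_ball hn r v0 ->
     (Z_norm_on hn zn half_line (fun t x => S u0 t x - S v0 t x)%R
       <= L%:E * hn (fun x => u0 x - v0 x)%R)%E).

Definition backward (S : fct -> R -> fct) : fct -> R -> fct :=
  fun u0 t => fconj (S (fconj u0) (- t)).

Definition scatters (hn : fct -> \bar R) (u : R -> fct) (F : set_system R) :
    Prop :=
  exists up : fct, H_space hn up /\
    hn (fun x => u t x - schrodinger t up x) @[t --> F] --> 0%E.

End Equation.

(* Main.v *)
Require Import Defs.
From mathcomp Require Import all_boot all_order all_algebra.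
From mathcomp Require Import all_classical all_reals all_analysis measurable_realfun.
From mathcomp Require Import complex lra.
Set Implicit Arguments.
Unset Strict Implicit.
Unset Printing Implicit Defensive.
Import Order.TTheory GRing.Theory Num.Theory.
Import numFieldNormedType.Exports.
Import ComplexField.Normc.
Local Open Scope classical_set_scope.
Local Open Scope ring_scope.

(** Scattering is a property of the solution space alone: every v in the space
    Z on the whole line scatters, and [S u0] agrees with such a v for t >= 0.

    The pullback w(t) = e^{-it Delta} v(t) lies in U^2, that is
    w = sum_j lam_j a_j with sum_j |lam_j| finite and a_j step functions of L2
    norm at most 1.  A step function is eventually constant, so every a_j has a
    final value b_j, and up = sum_j lam_j b_j converges in L2 ([L2_series]).
    Cutting the series at n costs at most sum_(j >= n) |lam_j| uniformly in
    time, and for large t the first n terms of w(t) and up coincide; hence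
    w(t) -> up in L2 ([U_rep_limit]).

    To upgrade this to the Sobolev norm, note that the propagator is unitary
    and commutes with the projections P_n.  So P_n (v(t) - e^{it Delta} up)
    tends to 0 in L2 for each n, and its norm is at most twice the U^2 norm
    A_n of P_n v, since the U^2 norm controls the supremum over time.  As
    sum_n 2^{2ns} A_n^2 is finite, dominated convergence for sums gives
    convergence in the Sobolev norm ([Hdot_scattering]); the inhomogeneous
    norm is the sum of two homogeneous ones.

    The backward statement is the forward one for conj u0, conjugated: this
    needs that conjugation preserves the norms and turns e^{it Delta} into
    e^{-it Delta}.  On the Fourier side, conjugation is conjugation composed
    with xi |-> - xi; this is read off from the Fourier integral on integrable
    functions and extends to L2 by density ([is_fourier_conj]).  All symbols
    in play are radial, hence insensitive to the reflection
    ([multiplier_conj]). *)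

(** * Complex and extended real numbers *)

Section ComplexFacts.
Context {R : realType}.
Implicit Types z w : R[i].

Lemma normc_ge0 z : 0 <= normc z.
Proof. by case: z => a b; exact: sqrtr_ge0. Qed.

Lemma sqr_normcE z : normc z ^+ 2 = complex.Re z ^+ 2 + complex.Im z ^+ 2.
Proof. by case: z => a b /=; rewrite sqr_sqrtr// addr_ge0 ?sqr_ge0. Qed.

Lemma dist_normc z w : `|normc z - normc w| <= normc (z - w).
Proof.
have := le_normcD (z - w) w; have := le_normcD (w - z) z.
by rewrite !subrK -[w - z]opprB normcN ler_norml => ? ?; lra.
Qed.

Lemma cconjM z w : ((z * w)^*)%C = ((z^*)%C * (w^*)%C).
Proof. exact: rmorphM. Qed.

Lemma cconjB z w : ((z - w)^*)%C = ((z^*)%C - (w^*)%C).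
Proof. exact: rmorphB. Qed.

Lemma normc_conj z : normc (z^*)%C = normc z.
Proof. by case: z => a b /=; rewrite !sqrrN. Qed.

Lemma normc_real (x : R) : normc (x%:C)%C = `|x|.
Proof. by rewrite /= expr0n/= addr0 sqrtr_sqr. Qed.

Lemma Re_le_normc z : `|complex.Re z| <= normc z.
Proof.
case: z => a b /=; rewrite -sqrtr_sqr ler_sqrt ?lerDl ?sqr_ge0//.
by rewrite addr_ge0 ?sqr_ge0.
Qed.

Lemma Im_le_normc z : `|complex.Im z| <= normc z.
Proof.
case: z => a b /=; rewrite -sqrtr_sqr ler_sqrt ?lerDr ?sqr_ge0//.
by rewrite addr_ge0 ?sqr_ge0.
Qed.

Lemma normc_le_ReIm z : normc z <= `|complex.Re z| + `|complex.Im z|.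
Proof.
rewrite -(@ler_pXn2r _ 2)// ?nnegrE ?addr_ge0 ?normc_ge0// sqr_normcE sqrrD.
rewrite !real_normK ?num_real// -addrA lerD2l lerDr mulrn_wge0// mulr_ge0//.
Qed.

Lemma normc_cis (x : R) : normc (cis x) = 1.
Proof. by rewrite /= cos2Dsin2 sqrtr1. Qed.

End ComplexFacts.

Section ExtendedSquares.
Context {R : realType}.
Implicit Types x y : \bar R.

Lemma sqre_poweR x : (0 <= x -> x ^+ 2 = x `^ 2)%E.
Proof.
case: x => [x||]//; last by rewrite poweRyr// expe2 mulyy.
by rewrite lee_fin => x0; rewrite poweR_EFin -EFin_expe powR_mulrn.
Qed.

Lemma le_sqre x y : (0 <= x)%E -> (0 <= y)%E -> (x ^+ 2 <= y ^+ 2)%E = (x <= y)%E.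
Proof.
move=> x0 y0; rewrite !sqre_poweR//; apply/idP/idP => [|xy].
  move=> h; have := @gt0_ler_poweR _ (2)^-1 _ (x `^ 2)%E (y `^ 2)%E.
  rewrite -!poweRrM mulfV// !poweRe1//; apply => //.
  - by rewrite in_itv/= poweR_ge0 leey.
  - by rewrite in_itv/= poweR_ge0 leey.
by apply: gt0_ler_poweR => //; rewrite in_itv/= ?x0 ?y0 leey.
Qed.

End ExtendedSquares.

Section CvgZero.
Context {R : realType} {T : Type} (F : set_system T) {FF : Filter F}.
Implicit Types f : T -> \bar R.

Lemma cvge0P f : (forall t, 0 <= f t)%E ->
  (f @ F --> 0%E) <-> (forall e : R, 0 < e -> \forall t \near F, (f t <= e%:E)%E).
Proof.
move=> f0; split=> [/fine_cvgP[fin /cvgrPdist_le cv] e e0|fe].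
  apply: filterS2 fin (cv e e0) => t /= ft; rewrite sub0r normrN => h.
  by rewrite -(fineK ft) lee_fin (le_trans (ler_norm _)).
apply/fine_cvgP; split.
  apply: filterS (fe 1 ltr01) => t ft.
  by rewrite ge0_fin_numE// (le_lt_trans ft)// ltry.
apply/cvgrPdist_le => e e0; apply: filterS (fe e e0) => t ft /=.
rewrite sub0r normrN ger0_norm ?fine_ge0//.
by rewrite -lee_fin fineK// ge0_fin_numE// (le_lt_trans ft)// ltry.
Qed.

End CvgZero.

(** * L2 norms of complex functions *)

Section L2Toolbox.
Context {R : realType} {d : nat}.
Local Notation Rd := (d.-tuple (measurableTypeR R)).
Local Notation fct := (Rd -> R[i]).
Local Notation leb := (lebesgue_tuple d).
Implicit Types f g h : fct.

Definition cmeas f := measurable_fun setT (fun x => complex.Re (f x)) /\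
  measurable_fun setT (fun x => complex.Im (f x)).

Lemma L2_cmeas f : L2 f -> cmeas f. Proof. by case. Qed.

Lemma L2_lty f : L2 f -> (L2norm f < +oo)%E. Proof. by case. Qed.

Lemma L2I f : cmeas f -> (L2norm f < +oo)%E -> L2 f.
Proof. by case=> ? ? ?; split. Qed.

Lemma cmeas_normc f : cmeas f -> measurable_fun setT (fun x => normc (f x)).
Proof.
move=> [mr mi].
rewrite (_ : (fun x => _) =
    (fun x => Num.sqrt (complex.Re (f x) ^+ 2 + complex.Im (f x) ^+ 2))).
  apply: (measurableT_comp (continuous_measurable_fun (@sqrt_continuous R))).
  by apply: measurable_funD; exact: measurable_funX.
by apply/funext => x; case: (f x).
Qed.

Lemma cmeasD f g : cmeas f -> cmeas g -> cmeas (fun x => f x + g x).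
Proof.
move=> [a b] [c e]; split.
  rewrite (_ : (fun x => _) = (fun x => complex.Re (f x) + complex.Re (g x))).
    exact: measurable_funD.
  by apply/funext => x; case: (f x) (g x) => ? ? [].
rewrite (_ : (fun x => _) = (fun x => complex.Im (f x) + complex.Im (g x))).
  exact: measurable_funD.
by apply/funext => x; case: (f x) (g x) => ? ? [].
Qed.

Lemma cmeasM f g : cmeas f -> cmeas g -> cmeas (fun x => f x * g x).
Proof.
move=> [a b] [c e]; split.
  rewrite (_ : (fun x => _) =
    (fun x => complex.Re (f x) * complex.Re (g x) -
              complex.Im (f x) * complex.Im (g x))).
    by apply: measurable_funB; exact: measurable_funM.
  by apply/funext => x; case: (f x) (g x) => ? ? [].
rewrite (_ : (fun x => _) =
    (fun x => complex.Re (f x) * complex.Im (g x) +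
              complex.Im (f x) * complex.Re (g x))).
  by apply: measurable_funD; exact: measurable_funM.
by apply/funext => x; case: (f x) (g x) => ? ? [].
Qed.

Lemma cmeas_cst (c : R[i]) : cmeas (fun=> c).
Proof. by split; exact: measurable_cst. Qed.

Lemma cmeas_conj f : cmeas f -> cmeas (fconj f).
Proof.
move=> [a b]; split.
  rewrite (_ : (fun x => _) = (fun x => complex.Re (f x)))//.
  by apply/funext => x; rewrite /fconj; case: (f x).
rewrite (_ : (fun x => _) = (fun x => - complex.Im (f x))).
  exact: measurableT_comp.
by apply/funext => x; rewrite /fconj; case: (f x).
Qed.

Lemma cmeasB f g : cmeas f -> cmeas g -> cmeas (fun x => f x - g x).
Proof.
move=> mf mg; rewrite (_ : (fun x => _) = (fun x => f x + (-1) * g x)).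
  by apply: cmeasD => //; apply: cmeasM => //; exact: cmeas_cst.
by apply/funext => x; rewrite mulN1r.
Qed.

Lemma cmeas_sum (s : seq nat) (F : nat -> fct) : (forall j, cmeas (F j)) ->
  cmeas (fun x => \sum_(j <- s) F j x).
Proof.
move=> mF; elim: s => [|n s IH].
  by under eq_fun do rewrite big_nil; exact: cmeas_cst.
by under eq_fun do rewrite big_cons; exact: cmeasD.
Qed.

Lemma L2normE f : L2norm f = ((\int[leb]_x ((normc (f x)) ^+ 2)%:E) `^ 2^-1)%E.
Proof.
rewrite /L2norm unlock; congr (_ `^ _)%E; apply: eq_integral => x _.
by rewrite abse_EFin ger0_norm ?normc_ge0// poweR_EFin powR_mulrn ?normc_ge0.
Qed.

Lemma L2norm_ge0 f : (0 <= L2norm f)%E.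
Proof. exact: Lnorm_ge0. Qed.

Lemma sqr_L2norm f : (L2norm f ^+ 2 = \int[leb]_x ((normc (f x)) ^+ 2)%:E)%E.
Proof.
rewrite sqre_poweR ?L2norm_ge0// L2normE -poweRrM mulVf// poweRe1//.
by apply: integral_ge0 => x _; rewrite lee_fin sqr_ge0.
Qed.

Lemma L2norm_le_ae f g : cmeas f -> cmeas g ->
  (\forall x \ae leb, normc (f x) <= normc (g x)) -> (L2norm f <= L2norm g)%E.
Proof.
move=> mf mg fg; rewrite -le_sqre ?L2norm_ge0// !sqr_L2norm.
apply: ae_ge0_le_integral => //.
- by move=> x _; rewrite lee_fin sqr_ge0.
- by apply/measurable_EFinP; apply: measurable_funX; exact: cmeas_normc.
- by move=> x _; rewrite lee_fin sqr_ge0.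
- by apply/measurable_EFinP; apply: measurable_funX; exact: cmeas_normc.
apply: filterS fg => x fg _; rewrite lee_fin.
by rewrite ler_sqr ?nnegrE ?normc_ge0.
Qed.

Lemma L2norm_le f g : cmeas f -> cmeas g ->
  (forall x, normc (f x) <= normc (g x)) -> (L2norm f <= L2norm g)%E.
Proof. by move=> mf mg fg; apply: L2norm_le_ae => //; exact: nearW. Qed.

Lemma L2norm_aeeq f g : cmeas f -> cmeas g -> aeeq f g -> L2norm f = L2norm g.
Proof.
move=> mf mg fg; apply/eqP; rewrite eq_le; apply/andP; split.
  by apply: L2norm_le_ae => //; apply: filterS fg => x ->.
by apply: L2norm_le_ae => //; apply: filterS fg => x ->.
Qed.

Lemma L2normD f g : cmeas f -> cmeas g ->
  (L2norm (fun x => f x + g x)%R <= L2norm f + L2norm g)%E.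
Proof.
move=> mf mg.
have mF := cmeas_normc mf; have mG := cmeas_normc mg.
apply: le_trans (minkowski_EFin leb mF mG (ler1n _ 2)).
set F : fct := fun x => ((normc (f x) + normc (g x))%:C)%C.
have -> : 'N[leb]_2%:E[EFin \o
    ((fun x => normc (f x)) \+ (fun x => normc (g x)))%R]%E = L2norm F.
  apply: eq_Lnorm => x /=.
  by rewrite expr0n/= addr0 sqrtr_sqr ger0_norm// addr_ge0 ?normc_ge0.
apply: L2norm_le; first exact: cmeasD.
  by split; [exact: measurable_funD|exact: measurable_cst].
move=> x; rewrite normc_real ger0_norm ?addr_ge0 ?normc_ge0//.
exact: le_normcD.
Qed.

Lemma L2normZ (c : R[i]) f : cmeas f ->
  L2norm (fun x => c * f x) = ((normc c)%:E * L2norm f)%E.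
Proof.
move=> mf; rewrite !L2normE.
under eq_integral => x _ do rewrite normcM exprMn EFinM.
rewrite ge0_integralZl_EFin ?sqr_ge0//; last 2 first.
  by move=> x _; rewrite lee_fin sqr_ge0.
  by apply/measurable_EFinP; apply: measurable_funX; exact: cmeas_normc.
rewrite poweRM ?lee_fin ?sqr_ge0//; last first.
  by apply: integral_ge0 => x _; rewrite lee_fin sqr_ge0.
by rewrite poweR_EFin -powR_mulrn ?normc_ge0// -powRrM mulfV// powRr1// normc_ge0.
Qed.

Lemma L2normN f : L2norm (fun x => - f x) = L2norm f.
Proof. by rewrite !L2normE; under eq_integral do rewrite normcN. Qed.

Lemma L2norm_conj f : L2norm (fconj f) = L2norm f.
Proof. by rewrite !L2normE; under eq_integral do rewrite /fconj normc_conj. Qed.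

Lemma L2norm_cst0 : L2norm ((fun=> 0) : fct) = 0%E.
Proof.
rewrite L2normE; under eq_integral do rewrite normc0 expr0n/=.
by rewrite integral0 poweR0r ?invr_neq0.
Qed.

Lemma L2normB f g : cmeas f -> cmeas g ->
  (L2norm (fun x => f x - g x)%R <= L2norm f + L2norm g)%E.
Proof.
move=> mf mg; rewrite -(L2normN g).
apply: L2normD => //.
rewrite (_ : (fun x => _) = (fun x => -1 * g x)); last by apply/funext => x; rewrite mulN1r.
by apply: cmeasM => //; exact: cmeas_cst.
Qed.

Lemma L2norm_distC f g : L2norm (fun x => f x - g x) = L2norm (fun x => g x - f x).
Proof. by rewrite -L2normN; congr L2norm; apply/funext => x; rewrite opprB. Qed.

Lemma L2_conj f : L2 f -> L2 (fconj f).
Proof.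
move=> Lf; apply: L2I; rewrite ?L2norm_conj; last exact: L2_lty.
exact/cmeas_conj/L2_cmeas.
Qed.

Lemma L2D f g : L2 f -> L2 g -> L2 (fun x => f x + g x).
Proof.
move=> Lf Lg; apply: L2I; first by apply: cmeasD; exact: L2_cmeas.
apply: le_lt_trans (L2normD (L2_cmeas Lf) (L2_cmeas Lg)) _.
by rewrite lte_add_pinfty// L2_lty.
Qed.

Lemma L2Z (c : R[i]) f : L2 f -> L2 (fun x => c * f x).
Proof.
move=> Lf; apply: L2I; first by apply: cmeasM; [exact: cmeas_cst|exact: L2_cmeas].
rewrite L2normZ; last exact: L2_cmeas.
by rewrite lte_mul_pinfty ?lee_fin ?normc_ge0// L2_lty.
Qed.

Lemma L2B f g : L2 f -> L2 g -> L2 (fun x => f x - g x).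
Proof.
move=> Lf Lg; rewrite (_ : (fun x => _) = (fun x => f x + (-1) * g x)).
  by apply: L2D => //; exact: L2Z.
by apply/funext => x; rewrite mulN1r.
Qed.

Lemma L2norm_eq0 f : cmeas f -> L2norm f = 0%E -> aeeq f (fun=> 0).
Proof.
move=> mf /Lnorm_eq0_eq0 h.
have {}h : (\forall x \ae leb, (normc (f x))%:E = 0%E).
  have : (fun x => (normc (f x))%:E) = \0%E %[ae leb].
    by apply: h => //; apply/measurable_EFinP; exact: cmeas_normc.
  by apply: filterS => x /(_ I).
by apply: filterS h => x [] /eq0_normc.
Qed.

Lemma aeeq_dist0 f g : cmeas f -> cmeas g ->
  L2norm (fun x => f x - g x) = 0%E -> aeeq f g.
Proof.
move=> mf mg /(L2norm_eq0 (cmeasB mf mg)).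
by apply: filterS => x /eqP; rewrite subr_eq0 => /eqP.
Qed.

Lemma L2norm_dist0 f g : cmeas f -> cmeas g -> aeeq f g ->
  L2norm (fun x => f x - g x) = 0%E.
Proof.
move=> mf mg fg; rewrite -L2norm_cst0; apply: L2norm_aeeq.
- exact: cmeasB.
- exact: cmeas_cst.
by apply: filterS fg => x ->; rewrite subrr.
Qed.

Lemma aeeq_refl f : aeeq f f. Proof. exact: nearW. Qed.
Lemma aeeq_sym f g : aeeq f g -> aeeq g f. Proof. by apply: filterS => x ->. Qed.
Lemma aeeq_trans g f h : aeeq f g -> aeeq g h -> aeeq f h.
Proof. by apply: filterS2 => x -> ->. Qed.
Lemma aeeq_conj f g : aeeq f g -> aeeq (fconj f) (fconj g).
Proof. by apply: filterS => x; rewrite /fconj => ->. Qed.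

Lemma L2norm_sum (s : seq nat) (F : nat -> fct) : (forall j, cmeas (F j)) ->
  (L2norm (fun x => \sum_(j <- s) F j x)%R <= \sum_(j <- s) L2norm (F j))%E.
Proof.
move=> mF; elim: s => [|n s IH].
  by under eq_fun do rewrite big_nil; rewrite big_nil L2norm_cst0.
under eq_fun do rewrite big_cons.
rewrite big_cons; apply: le_trans (L2normD _ _) _; [exact: mF|exact: cmeas_sum|].
exact: leeD2l.
Qed.

(** Fatou's lemma for |F_n|^2. *)
Lemma L2norm_fatou (F : nat -> fct) f (M : \bar R) : (forall n, cmeas (F n)) ->
  (forall x, (normc (F n x - f x)) @[n --> \oo] --> 0) ->
  (\forall n \near \oo, L2norm (F n) <= M)%E -> (L2norm f <= M)%E.
Proof.
move=> mF Ff FM.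
have M0 : (0 <= M)%E.
  by case: FM => n _ /(_ n (leqnn n)); apply: le_trans; exact: L2norm_ge0.
have sqF x : ((normc (F n x)) ^+ 2)%:E @[n --> \oo] --> ((normc (f x)) ^+ 2)%:E.
  apply: cvg_EFin; first exact: nearW.
  have cF : normc (F n x) @[n --> \oo] --> normc (f x).
    apply/cvgrPdist_le => e e0.
    have /cvgrPdist_le/(_ _ e0) := Ff x.
    apply: filterS => n; rewrite sub0r normrN ger0_norm ?normc_ge0//.
    by apply: le_trans; rewrite distrC; exact: dist_normc.
  rewrite /comp/= expr2; under eq_fun do rewrite expr2.
  exact: cvgM.
rewrite -le_sqre ?L2norm_ge0// sqr_L2norm.
under eq_integral => x _ do rewrite -(cvg_limn_einf_sup (sqF x)).1.
apply: le_trans (fatou _ _ _ _) _ => //.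
- move=> n; apply/measurable_EFinP; apply: measurable_funX.
  exact: cmeas_normc.
- by move=> n x _; rewrite lee_fin sqr_ge0.
rewrite limn_einf_lim; apply: lime_le; first exact: is_cvg_einfs.
apply: filterS FM => n FM; apply: (@le_trans _ _ (L2norm (F n) ^+ 2)%E).
  by rewrite sqr_L2norm; apply: ereal_inf_lbound; exists n => /=.
by rewrite le_sqre ?L2norm_ge0.
Qed.

(** Completeness of L2, in the form of absolutely convergent series.  By
    monotone convergence [sum_j |b_j x|] is square integrable, hence finite for
    almost every x; there [sum_j b_j x] converges absolutely, and Fatou's lemma
    bounds the remainders. *)
Lemma L2_series (b : nat -> fct) (c : nat -> R) : (forall j, cmeas (b j)) ->
  (forall j, L2norm (b j) <= (c j)%:E)%E -> (\sum_(0 <= j <oo) (c j)%:E < +oo)%E ->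
  exists g, L2 g /\ forall n,
    (L2norm (fun x => g x - \sum_(j < n) b j x)%R <= \sum_(n <= j <oo) (c j)%:E)%E.
Proof.
move=> mb bc coo.
have c0 j : (0 <= (c j)%:E)%E by apply: le_trans (bc j); exact: L2norm_ge0.
set M := (\sum_(0 <= j <oo) (c j)%:E)%E in coo.
pose h n x := \sum_(j < n) normc (b j x).
have mh n : measurable_fun setT (h n).
  by apply: measurable_sum => j; exact: cmeas_normc.
have h0 n x : 0 <= h n x by apply: sumr_ge0 => j _; exact: normc_ge0.
have ndh x : nondecreasing_seq (h ^~ x).
  by apply/nondecreasing_seqP => n; rewrite /h big_ord_recr/= lerDl normc_ge0.
pose G x := limn (fun n => ((h n x) ^+ 2)%:E).
have ndG x : nondecreasing_seq (fun n => ((h n x) ^+ 2)%:E).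
  by move=> n m nm; rewrite lee_fin ler_sqr ?nnegrE//; exact: ndh.
have mG : measurable_fun setT G.
  apply: (emeasurable_fun_cvg (fun n x => ((h n x) ^+ 2)%:E)) => [n|x _].
    by apply/measurable_EFinP; exact: measurable_funX.
  exact: ereal_nondecreasing_is_cvgn.
have Gae : \forall x \ae leb, G x \is a fin_num.
  suff : leb.-integrable setT G.
    by move/integrable_ae => /(_ measurableT); apply: filterS => x /(_ I).
  apply/integrableP; split => //.
  have G0 x : (0 <= G x)%E.
    apply: lime_ge; first exact: ereal_nondecreasing_is_cvgn.
    by apply: nearW => n; rewrite lee_fin sqr_ge0.
  under eq_integral => x _ do rewrite gee0_abs//.
  apply: (@le_lt_trans _ _ (M ^+ 2)%E); last first.
    by rewrite expe2 lte_mul_pinfty// ?nneseries_ge0// ge0_fin_numE// nneseries_ge0.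
  rewrite monotone_convergence//; last 2 first.
  - by move=> n; apply/measurable_EFinP; exact: measurable_funX.
  - by move=> n x _; rewrite lee_fin sqr_ge0.
  apply: lime_le.
    apply: ereal_nondecreasing_is_cvgn => n m nm.
    apply: ge0_le_integral => //.
    - by move=> x _; rewrite lee_fin sqr_ge0.
    - by apply/measurable_EFinP; exact: measurable_funX.
    - by apply/measurable_EFinP; exact: measurable_funX.
    - by move=> x _; exact: ndG.
  apply: nearW => n.
  pose B j : fct := fun x => ((normc (b j x))%:C)%C.
  have mB j : cmeas (B j) by split; [exact: cmeas_normc|exact: measurable_cst].
  have -> : (\int[leb]_x ((h n x) ^+ 2)%:E =
      (L2norm (fun x => \sum_(0 <= j < n) B j x)%R) ^+ 2)%E.
    rewrite sqr_L2norm; apply: eq_integral => x _; congr (_%:E).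
    rewrite /h big_mkord (_ : \sum_(j < n) B j x = ((h n x)%:C)%C); last first.
      by rewrite /h rmorph_sum.
    by rewrite normc_real ger0_norm.
  rewrite le_sqre ?L2norm_ge0 ?nneseries_ge0//.
  apply: le_trans (L2norm_sum _ mB) _.
  apply: (@le_trans _ _ (\sum_(0 <= j < n) (c j)%:E)%E).
    apply: lee_sum => j _; apply: le_trans (bc j).
    by apply: L2norm_le => // x; rewrite normc_real ger0_norm ?normc_ge0.
  exact: nneseries_lim_ge.
(* Setting the terms to 0 off A makes the series converge at every x. *)
pose A := [set x | G x \is a fin_num].
have mA : measurable A.
  by rewrite -[X in measurable X]setTI; exact: emeasurable_fin_num.
pose b' j : fct := fun x => (((\1_A x : R)%:C)%C * b j x).
have mb' j : cmeas (b' j).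
  by apply: cmeasM => //; split; [exact: measurable_indic|exact: measurable_cst].
have b'b : \forall x \ae leb, forall j, b' j x = b j x.
  by apply: filterS Gae => x Gx j; rewrite /b' indicE mem_set// mul1r.
have cvgb x : cvgn (series (fun j => normc (b' j x))).
  have [Ax|nAx] := pselect (A x); last first.
    rewrite (_ : (fun j => _) = (fun=> 0)); last first.
      by apply/funext => j; rewrite /b' indicE memNset// mul0r normc0.
    rewrite (_ : series _ = (fun=> 0)); first exact: is_cvg_cst.
    by apply/funext => n; rewrite /series/= big1.
  rewrite (_ : (fun j => _) = (fun j => normc (b j x))); last first.
    by apply/funext => j; rewrite /b' indicE mem_set// mul1r.
  rewrite (_ : series _ = (h ^~ x)); last by apply/funext => n; rewrite /series/= big_mkord.
  apply: nondecreasing_is_cvgn => //.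
  exists (1 + fine (G x)) => _ [n _ <-].
  have : h n x ^+ 2 <= fine (G x).
    rewrite -lee_fin fineK//; apply: lime_ge; first exact: ereal_nondecreasing_is_cvgn.
    by exists n => // m /= nm; exact: ndG.
  (* h <= 1 + h^2 *)
  by move: (h0 n x); nra.
have cvgRe x : cvgn (series (fun j => complex.Re (b' j x))).
  apply: normed_cvg; apply: (series_le_cvg _ _ _ (cvgb x)) => n //=; first exact: normc_ge0.
  exact: Re_le_normc.
have cvgIm x : cvgn (series (fun j => complex.Im (b' j x))).
  apply: normed_cvg; apply: (series_le_cvg _ _ _ (cvgb x)) => n //=; first exact: normc_ge0.
  exact: Im_le_normc.
pose g : fct := fun x => (limn (series (fun j => complex.Re (b' j x))) +i*
  limn (series (fun j => complex.Im (b' j x))))%C.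
have Re_sum (s : seq nat) (F : nat -> R[i]) :
    complex.Re (\sum_(j <- s) F j) = \sum_(j <- s) complex.Re (F j).
  by elim/big_rec2 : _ => // j z w _ <-; case: (F j) w => ? ? [].
have Im_sum (s : seq nat) (F : nat -> R[i]) :
    complex.Im (\sum_(j <- s) F j) = \sum_(j <- s) complex.Im (F j).
  by elim/big_rec2 : _ => // j z w _ <-; case: (F j) w => ? ? [].
have mg : cmeas g.
  split.
    apply: (@measurable_fun_cvg _ _ R setT
      (fun n (x : Rd) => \sum_(0 <= j < n) complex.Re (b' j x))).
      by move=> n; apply: measurable_sum => j; case: (mb' j).
    by move=> x _; exact: cvgRe.
  apply: (@measurable_fun_cvg _ _ R setT
      (fun n (x : Rd) => \sum_(0 <= j < n) complex.Im (b' j x))).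
    by move=> n; apply: measurable_sum => j; case: (mb' j).
  by move=> x _; exact: cvgIm.
have tail n : (L2norm (fun x => g x - \sum_(j < n) b j x)%R <=
    \sum_(n <= j <oo) (c j)%:E)%E.
  have mS m (B : nat -> fct) : (forall j, cmeas (B j)) ->
      cmeas (fun x => \sum_(j < m) B j x).
    move=> mB; under eq_fun do rewrite -(big_mkord xpredT (fun j => B j _)).
    exact: cmeas_sum.
  rewrite (@L2norm_aeeq _ (fun x => g x - \sum_(j < n) b' j x)); last 3 first.
  - by apply: cmeasB => //; exact: mS.
  - by apply: cmeasB => //; exact: mS.
  - by apply: filterS b'b => x b'b; under [in RHS]eq_bigr do rewrite b'b.
  apply: (@L2norm_fatou (fun m x => \sum_(n <= j < n + m) b' j x)).
  - by move=> m; exact: cmeas_sum.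
  - move=> x.
    pose u m := complex.Re (\sum_(0 <= j < m) b' j x).
    pose v m := complex.Im (\sum_(0 <= j < m) b' j x).
    have cu : u m @[m --> \oo] --> complex.Re (g x).
      by under eq_fun do rewrite /u Re_sum; exact: cvgRe.
    have cv : v m @[m --> \oo] --> complex.Im (g x).
      by under eq_fun do rewrite /v Im_sum; exact: cvgIm.
    apply: (@squeeze_cvgr _ _ _ _ (fun=> 0)
      (fun m => `|u (n + m)%N - complex.Re (g x)| + `|v (n + m)%N - complex.Im (g x)|)).
    - apply: nearW => m; rewrite normc_ge0/= (le_trans (normc_le_ReIm _))//.
      rewrite opprB addrA -[X in _ + X - _](big_mkord xpredT (fun j => b' j x)).
      rewrite [X in X - g x]addrC -big_cat_nat ?leq_addr//= /u /v.
      by rewrite /g; case: (\sum_(0 <= j < n + m) _) => ? ? /=.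
    - exact: cvg_cst.
    rewrite -[X in _ --> X]addr0; apply: cvgD.
      rewrite -(normr0 R) -(subrr (complex.Re (g x))).
      apply: cvg_norm; apply: cvgB; last exact: cvg_cst.
      by under eq_fun do rewrite addnC; have := cu; rewrite -(cvg_shiftn n).
    rewrite -(normr0 R) -(subrr (complex.Im (g x))).
      apply: cvg_norm; apply: cvgB; last exact: cvg_cst.
    by under eq_fun do rewrite addnC; have := cv; rewrite -(cvg_shiftn n).
  apply: nearW => m; apply: le_trans (L2norm_sum _ mb') _.
  apply: (@le_trans _ _ (\sum_(n <= j < n + m) (c j)%:E)%E).
    apply: lee_sum => j _; rewrite -(@L2norm_aeeq (b j))//.
    by apply: filterS b'b => x ->.
  exact: nneseries_lim_ge.
exists g; split => //; apply: L2I => //.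
apply: le_lt_trans coo; have := tail 0; congr (_ <= _)%E.
by congr L2norm; apply/funext => x; rewrite big_ord0 subr0.
Qed.

End L2Toolbox.
(** * Reflection invariance of Lebesgue measure *)

Section Reflection.
Context {R : realType}.
Local Notation mR := (measurableTypeR R).

Definition refl n (x : n.-tuple mR) : n.-tuple mR := [tuple - tnth x i | i < n].

Lemma measurable_refl n : measurable_fun [set: n.-tuple mR] (@refl n).
Proof.
apply/measurable_fun_tnthP => i.
rewrite (_ : _ \o _ = (fun x : n.-tuple mR => - tnth x i)).
  by apply: measurable_funN; exact: measurable_tnth.
by apply/funext => x /=; rewrite tnth_mktuple.
Qed.

Lemma refl_tcons n (p : mR * n.-tuple mR) : refl (tcons p) = tcons (- p.1, refl p.2).
Proof.
apply: eq_from_tnth => i; rewrite tnth_mktuple.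
case: (unliftP ord0 i) => [j ->|->]; last by rewrite !tnth0.
by rewrite !tnthS tnth_mktuple.
Qed.

Lemma ge0_integral_oppr (f : mR -> \bar R) : measurable_fun setT f ->
  (forall x, 0 <= f x)%E ->
  (\int[lebesgue_measure]_x f (- x)%R = \int[lebesgue_measure]_x f x)%E.
Proof.
move=> mf f0.
have mN : measurable_fun setT (-%R : mR -> mR) by exact: oppr_measurable.
rewrite -(@eq_measure_integral _ _ _ _ lebesgue_measure
    (pushforward lebesgue_measure (-%R : mR -> mR))) => [|A mA _].
  rewrite ge0_integral_pushforward//; last exact: measurableT_comp mN.
  by rewrite preimage_setT; apply: eq_integral => x _ /=; rewrite opprK.
exact: lebesgue_measureN.
Qed.

(** By induction on the dimension: the slices of the reflected set are the
    reflected slices, taken at the opposite first coordinate. *)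
Lemma lebesgue_tuple_refl n (A : set (n.-tuple mR)) : measurable A ->
  lebesgue_tuple n (@refl n @^-1` A) = lebesgue_tuple n A.
Proof.
elim: n A => [|n IH] A mA.
  congr (lebesgue_tuple 0 _); apply/funext => x /=.
  by rewrite /preimage/= (tuple0 (refl x)) -(tuple0 x).
have mT (B : set (n.+1.-tuple mR)) : measurable B -> measurable (@tcons R n @^-1` B).
  by move=> mB; rewrite -[X in measurable X]setTI; exact: measurable_tcons.
have mrA : measurable (@refl n.+1 @^-1` A).
  by rewrite -[X in measurable X]setTI; exact: measurable_refl.
rewrite /= /lebesgue_step /pushforward /product_measure1 /=.
rewrite -[RHS]ge0_integral_oppr//; last first.
  by apply: measurable_fun_xsection; exact: mT.
apply: eq_integral => x _ /=.
have mx : measurable (xsection (@tcons R n @^-1` A) (- x)).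
  by apply: measurable_xsection; exact: mT.
rewrite -(IH _ mx); congr (lebesgue_tuple n _).
apply/seteqP; split => y; rewrite /preimage/= /xsection/= !inE/= refl_tcons//.
Qed.

End Reflection.
(** * The Fourier transform of a conjugate *)

Section Fourier.
Context {R : realType} {d : nat}.
Local Notation Rd := (d.-tuple (measurableTypeR R)).
Local Notation fct := (Rd -> R[i]).
Local Notation leb := (lebesgue_tuple d).
Local Notation rf := (@refl R d).
Implicit Types f g h : fct.

Lemma enorm_refl (x : Rd) : enorm (rf x) = enorm x.
Proof.
by rewrite /enorm /dotp; congr Num.sqrt; apply: eq_bigr => i _;
  rewrite tnth_mktuple mulrNN.
Qed.

Lemma dotp_refl (x y : Rd) : dotp x (rf y) = - dotp x y.
Proof.
by rewrite /dotp -sumrN; apply: eq_bigr => i _; rewrite tnth_mktuple mulrN.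
Qed.

Lemma aeeq_comp_refl f g : aeeq f g -> aeeq (f \o rf) (g \o rf).
Proof.
move=> [N [mN N0 fgN]]; exists (rf @^-1` N); split.
- by rewrite -[X in measurable X]setTI; exact: measurable_refl.
- exact: etrans (lebesgue_tuple_refl mN) N0.
- by move=> x /= fgx; exact: fgN.
Qed.

Lemma cmeas_comp_refl f : cmeas f -> cmeas (f \o rf).
Proof.
case=> mr mi; have mrf := @measurable_refl R d.
by split; [exact: (measurableT_comp mr mrf)|exact: (measurableT_comp mi mrf)].
Qed.

Lemma L2norm_comp_refl f : cmeas f -> L2norm (f \o rf) = L2norm f.
Proof.
move=> mf; rewrite !L2normE; congr (_ `^ _)%E.
have mf2 : measurable_fun setT (fun x => ((normc (f x)) ^+ 2)%:E).
  by apply/measurable_EFinP; apply: measurable_funX; exact: cmeas_normc.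
have := @ge0_integral_pushforward _ _ _ _ _ _ (@measurable_refl R d) leb setT _
  measurableT mf2.
rewrite preimage_setT /comp => <-; last by move=> x _; rewrite lee_fin sqr_ge0.
apply: eq_measure_integral; first exact: measurable_refl.
by move=> mr A mA _; exact: lebesgue_tuple_refl.
Qed.

(** When the positive and negative parts of g both have infinite integral, both
    sides are 0, since [fine] sends infinities to 0. *)
Lemma Rintegral_oppr disp (T : measurableType disp) (mu : {measure set T -> \bar R})
  (D : set T) (g : T -> R) :
  \int[mu]_(x in D) (- g x) = - \int[mu]_(x in D) g x.
Proof.
rewrite /Rintegral; under eq_integral do rewrite EFinN.
rewrite integralE [in RHS]integralE funeposN funenegN.
by case: (\int[mu]_(x in D) _)%E (\int[mu]_(x in D) _)%E => [a||] [b||] //=;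
  rewrite ?oppr0// opprB.
Qed.

Lemma cintegral_conj disp (T : measurableType disp) (mu : {measure set T -> \bar R})
  (D : set T) (g : T -> R[i]) :
  cintegral mu D (fun x => (g x)^*%C) = ((cintegral mu D g)^*)%C.
Proof.
rewrite /cintegral/= -Rintegral_oppr; congr (_ +i* _)%C;
  by apply: eq_Rintegral => x _; case: (g x).
Qed.

Lemma fourier_integral_conj f xi :
  fourier_integral (fconj f) xi = ((fourier_integral f (rf xi))^*)%C.
Proof.
rewrite /fourier_integral cconjM conjc_real; congr (_ * _).
rewrite -cintegral_conj; congr (cintegral _ _ _); apply/funext => x.
rewrite dotp_refl opprK cconjM; congr (_ * _).
by rewrite /cis/= cosN sinN.
Qed.

Lemma cintegrable_conj f : cintegrable leb setT f -> cintegrable leb setT (fconj f).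
Proof.
case=> ir ii; split.
  by apply: eq_integrable ir => // x _; rewrite /fconj; case: (f x).
have := integrableN ii; apply: eq_integrable => // x _.
by rewrite /fconj /=; case: (f x) => ? ? /=; rewrite EFinN.
Qed.

(** Cutting off the set where |f| < 1/(n+1) makes f integrable, because
    |f| <= (n+1) |f|^2 elsewhere, and the part cut off tends to 0 in L2. *)
Lemma L1_dense f (e : R) : 0 < e -> L2 f ->
  exists g, [/\ L2 g, cintegrable leb setT g &
    (L2norm (fun x => f x - g x)%R <= e%:E)%E].
Proof.
move=> e0 Lf; have mf := L2_cmeas Lf; have mN := cmeas_normc mf.
pose A n := [set x | n.+1%:R^-1 <= normc (f x)].
have mA n : measurable (A n).
  have := measurable_fun_ler (@measurable_cst _ _ _ _ setT (n.+1%:R^-1 : R)) mN.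
  move=> /(_ measurableT [set true] I); rewrite setTI.
  by congr measurable; apply/seteqP; split => x.
pose g n : fct := fun x => ((\1_(A n) x : R)%:C)%C * f x.
have mg n : cmeas (g n).
  by apply: cmeasM => //; split; [exact: measurable_indic|exact: measurable_cst].
have gf n x : normc (g n x) <= normc (f x).
  rewrite /g normcM normc_real indicE.
  by case: (x \in A n) => /=; rewrite ?normr1 ?mul1r// normr0 mul0r normc_ge0.
have gf1 n x : normc (g n x) <= n.+1%:R * (normc (f x)) ^+ 2.
  rewrite /g normcM normc_real indicE.
  have [|_] := boolP (x \in A n); last first.
    by rewrite normr0 mul0r mulr_ge0 ?sqr_ge0.
  rewrite inE => Anx; rewrite normr1 mul1r expr2 mulrA ler_peMl ?normc_ge0//.
  by rewrite -ler_pdivrMl ?mulr1.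
have Lg n : L2 (g n).
  apply: L2I => //; apply: le_lt_trans (L2norm_le (mg n) mf (gf n)) _; exact: L2_lty.
have isq : leb.-integrable setT (fun x => ((normc (f x)) ^+ 2)%:E).
  apply/integrableP; split; first by apply/measurable_EFinP; exact: measurable_funX.
  under eq_integral => x _ do rewrite gee0_abs ?lee_fin ?sqr_ge0//.
  rewrite -sqr_L2norm expe2 lte_mul_pinfty ?L2norm_ge0//; last exact: L2_lty.
  by rewrite ge0_fin_numE ?L2norm_ge0// L2_lty.
have ig n : cintegrable leb setT (g n).
  have isn := integrableZl measurableT n.+1%:R isq.
  case: (mg n) => mr mi; split.
    apply: (@le_integrable _ _ _ _ _ measurableT _ _ _ _ isn).
      exact/measurable_EFinP.
    move=> x _ /=; rewrite lee_fin (le_trans (Re_le_normc _))// (le_trans (gf1 _ _))//.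
    exact: ler_norm.
  apply: (@le_integrable _ _ _ _ _ measurableT _ _ _ _ isn).
    exact/measurable_EFinP.
  move=> x _ /=; rewrite lee_fin (le_trans (Im_le_normc _))// (le_trans (gf1 _ _))//.
  exact: ler_norm.
have [] := @dominated_convergence _ _ _ leb setT measurableT
    (fun n x => ((normc (f x - g n x)) ^+ 2)%:E) (cst 0%E)
    (fun x => ((normc (f x)) ^+ 2)%:E).
  - move=> n; apply/measurable_EFinP; apply: measurable_funX; apply: cmeas_normc.
    exact: cmeasB.
  - exact: measurable_cst.
  - apply: nearW => x _.
    have [fx0|fx0] := eqVneq (f x) 0.
      rewrite (_ : (fun n => _) = (fun=> 0%E)); first exact: cvg_cst.
      by apply/funext => n; rewrite /g fx0 mulr0 subrr normc0 expr0n.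
    have fx1 : 0 < normc (f x).
      by rewrite lt_def normc_ge0 andbT; apply: contra fx0 => /eqP/eq0_normc ->.
    apply: cvg_near_cst.
    apply: filterS (near_infty_natSinv_lt (PosNum fx1)) => n /= /ltW An.
    rewrite /g indicE mem_set// mul1r subrr normc0 expr0n//.
  - exact: isq.
  - apply: nearW => x n _; rewrite abse_EFin lee_fin ger0_norm ?sqr_ge0//.
    rewrite ler_sqr ?nnegrE ?normc_ge0// /g indicE.
    by case: (x \in A n) => /=;
      rewrite ?mul1r ?subrr ?mul0r ?subr0// normc0 normc_ge0.
move=> _ _ /=; rewrite integral0 => cvg0.
have e20 : (0 < e ^+ 2) by rewrite exprn_gt0.
have [n _ /(_ n (leqnn n))/= hn] : \forall n \near \oo,
    (\int[leb]_x ((normc (f x - g n x)) ^+ 2)%:E <= (e ^+ 2)%:E)%E.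
  apply: (cvge0P _).1 cvg0 _ e20 => n.
  by apply: integral_ge0 => x _; rewrite lee_fin sqr_ge0.
move: hn; rewrite -sqr_L2norm EFin_expe le_sqre ?L2norm_ge0 ?lee_fin ?(ltW e0)// => le_e.
by exists (g n); split.
Qed.

(** Both sides are isometric in f, and they agree on the dense subspace of
    integrable functions, where the Fourier integral is available. *)
Lemma is_fourier_conj (U : (fct -> fct) * (fct -> fct)) f : is_fourier U -> L2 f ->
  aeeq (U.1 (fconj f)) (fconj (U.1 f) \o rf).
Proof.
case=> UL Uiso Ulin _ Uint Lf.
have UB g h : L2 g -> L2 h ->
    L2norm (fun x => U.1 g x - U.1 h x) = L2norm (fun x => g x - h x).
  move=> Lg Lh; rewrite -(Uiso (fun x => g x - h x)); last exact: L2B.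
  have [Lg1 _] := UL _ Lg; have [Lh1 _] := UL _ Lh.
  have E k k' : (fun x : Rd => -1 * k x + k' x) = (fun x => k' x - k x) :> fct.
    by apply/funext => x; rewrite mulN1r addrC.
  apply/esym/L2norm_aeeq.
  - by case: (UL _ (L2B Lg Lh)) => /L2_cmeas.
  - by apply: cmeasB; exact: L2_cmeas.
  - by have := Ulin (-1) h g Lh Lg; rewrite !E.
have L1 g : L2 g -> cintegrable leb setT g ->
    aeeq (U.1 (fconj g)) (fconj (U.1 g) \o rf).
  move=> Lg ig.
  have := aeeq_conj (aeeq_comp_refl (Uint g Lg ig)).
  have := Uint _ (L2_conj Lg) (cintegrable_conj ig).
  apply: filterS2 => xi -> h; rewrite fourier_integral_conj; exact: esym.
have m0 g : L2 g -> cmeas (U.1 g) by move=> Lg; case: (UL _ Lg) => /L2_cmeas.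
have m1 g : L2 g -> cmeas (U.1 (fconj g)).
  by move=> Lg; exact/m0/L2_conj.
have m2 g : L2 g -> cmeas (fconj (U.1 g) \o rf).
  by move=> Lg; apply: cmeas_comp_refl; apply: cmeas_conj; exact: m0.
apply: aeeq_dist0; [exact: m1|exact: m2|].
apply/eqP; rewrite eq_le L2norm_ge0 andbT; apply/lee_addgt0Pr => e e0; rewrite add0e.
have e20 : 0 < e / 2 by rewrite divr_gt0.
have [g [Lg ig fge]] := L1_dense e20 Lf.
rewrite (_ : (fun x => _) = (fun x => (U.1 (fconj f) x - U.1 (fconj g) x)
  + (U.1 (fconj g) x - (fconj (U.1 f) \o rf) x))); last first.
  by apply/funext => x; rewrite addrA subrK.
apply: le_trans (L2normD _ _) _; first by apply: cmeasB; exact: m1.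
  by apply: cmeasB; [exact: m1|exact: m2].
rewrite [e]splitr EFinD; apply: leeD.
  rewrite UB; [|exact: L2_conj..].
  rewrite (_ : (fun x => _) = fconj (fun x => f x - g x)); last first.
    by apply/funext => x; rewrite /fconj cconjB.
  by rewrite L2norm_conj.
rewrite (@L2norm_aeeq _ _ _ (fconj (fun x => U.1 g x - U.1 f x) \o rf)).
- rewrite L2norm_comp_refl; last by apply: cmeas_conj; apply: cmeasB; exact: m0.
  by rewrite L2norm_conj UB// L2norm_distC.
- by apply: cmeasB; [exact: m1|exact: m2].
- by apply: cmeas_comp_refl; apply: cmeas_conj; apply: cmeasB; exact: m0.
- by apply: filterS (L1 _ Lg ig) => x -> /=; rewrite /fconj cconjB.
Qed.

End Fourier.
(** * Fourier multipliers *)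

Section Multipliers.
Context {R : realType} {d : nat}.
Local Notation Rd := (d.-tuple (measurableTypeR R)).
Local Notation fct := (Rd -> R[i]).
Local Notation leb := (lebesgue_tuple d).
Implicit Types (f g h : fct) (M : fct).

Definition unitary_pair (U : (fct -> fct) * (fct -> fct)) : Prop :=
  [/\ forall f, L2 f -> L2 (U.1 f) /\ L2 (U.2 f),
      forall f, L2 f -> L2norm (U.1 f) = L2norm f,
      forall (c : R[i]) f g, L2 f -> L2 g ->
        aeeq (U.1 (fun x => c * f x + g x)) (fun x => c * U.1 f x + U.1 g x) &
      forall f, L2 f -> aeeq (U.2 (U.1 f)) f /\ aeeq (U.1 (U.2 f)) f].

(** The symmetry of the transform under conjugation, up to a norm-preserving map
    of the frequency space: for the Fourier transform this map is xi |-> - xi. *)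
Definition conj_symmetric (U : (fct -> fct) * (fct -> fct)) : Prop :=
  exists rho : Rd -> Rd,
    [/\ forall f g, aeeq f g -> aeeq (f \o rho) (g \o rho),
        forall x, enorm (rho x) = enorm x &
        forall f, L2 f -> aeeq (U.1 (fconj f)) (fconj (U.1 f) \o rho)].

(** [fourier_pair] is an [xget]: either it satisfies [is_fourier], or it is the
    default pair of identities.  Both have the two properties; for the
    identities the frequency map is trivial. *)
Lemma fourier_pair_spec :
  unitary_pair (@fourier_pair R d) /\ conj_symmetric (@fourier_pair R d).
Proof.
rewrite /fourier_pair; case: xgetP => [U _ /= hU|_].
  split; first by case: hU.
  exists (@refl R d); split; [exact: aeeq_comp_refl|exact: enorm_refl|].
  by move=> f Lf; exact: is_fourier_conj.
split; first by split=> //= *; do ?split => //; exact: aeeq_refl.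
by exists id; split => //= f _; exact: aeeq_refl.
Qed.

Lemma fourier_L2 f : L2 f -> L2 (fourier f).
Proof. by have [[UL _ _ _] _] := fourier_pair_spec; case/UL. Qed.

Lemma ifourier_L2 f : L2 f -> L2 (ifourier f).
Proof. by have [[UL _ _ _] _] := fourier_pair_spec; case/UL. Qed.

Lemma L2norm_fourier f : L2 f -> L2norm (fourier f) = L2norm f.
Proof. by have [[_ Uiso _ _] _] := fourier_pair_spec; exact: Uiso. Qed.

Lemma fourierK f : L2 f -> aeeq (ifourier (fourier f)) f.
Proof. by have [[_ _ _ UK] _] := fourier_pair_spec; case/UK. Qed.

Lemma ifourierK f : L2 f -> aeeq (fourier (ifourier f)) f.
Proof. by have [[_ _ _ UK] _] := fourier_pair_spec; case/UK. Qed.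

Lemma L2norm_ifourier f : L2 f -> L2norm (ifourier f) = L2norm f.
Proof.
move=> Lf; rewrite -L2norm_fourier; last exact: ifourier_L2.
apply: L2norm_aeeq.
- exact/L2_cmeas/fourier_L2/ifourier_L2.
- exact: L2_cmeas.
exact: ifourierK.
Qed.

Lemma fourierB f g : L2 f -> L2 g ->
  aeeq (fourier (fun x => f x - g x)) (fun x => fourier f x - fourier g x).
Proof.
move=> Lf Lg; have [[_ _ Ulin _] _] := fourier_pair_spec.
have E k k' : (fun x : Rd => -1 * k x + k' x) = (fun x => k' x - k x) :> fct.
  by apply/funext => x; rewrite mulN1r addrC.
by have := Ulin (-1) g f Lg Lf; rewrite !E.
Qed.

Lemma L2norm_fourierB f g : L2 f -> L2 g ->
  L2norm (fun x => fourier f x - fourier g x) = L2norm (fun x => f x - g x).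
Proof.
move=> Lf Lg; rewrite -(L2norm_fourier (L2B Lf Lg)); apply/esym/L2norm_aeeq.
- exact/L2_cmeas/fourier_L2/L2B.
- by apply: cmeasB; exact/L2_cmeas/fourier_L2.
- exact: fourierB.
Qed.

Lemma fourier_aeeq f g : L2 f -> L2 g -> aeeq f g -> aeeq (fourier f) (fourier g).
Proof.
move=> Lf Lg fg; apply: aeeq_dist0; [exact/L2_cmeas/fourier_L2..|].
by rewrite L2norm_fourierB//; apply: L2norm_dist0 => //; exact: L2_cmeas.
Qed.

Lemma fourier_inj f g : L2 f -> L2 g -> aeeq (fourier f) (fourier g) -> aeeq f g.
Proof.
move=> Lf Lg fg; apply: aeeq_dist0; [exact/L2_cmeas..|].
by rewrite -L2norm_fourierB//; apply: L2norm_dist0 => //; exact/L2_cmeas/fourier_L2.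
Qed.

(** [schrodinger t] and [LP chi n] unfold to instances of this operator, so the
    lemmas below apply to them as they stand. *)
Definition multiplier M f : fct := ifourier (fun xi => M xi * fourier f xi).

Definition bounded_symbol M := cmeas M /\ exists C : R, forall x, normc (M x) <= C.

Section bounded_symbol.
Variables (M : fct) (bM : bounded_symbol M).

Lemma L2_symbolM f : L2 f -> L2 (fun x => M x * f x).
Proof.
move=> Lf; case: bM => mM [C MC].
have mMf : cmeas (fun x => M x * f x) by apply: cmeasM => //; exact: L2_cmeas.
apply: L2I => //; apply: le_lt_trans (L2_lty (L2Z (C%:C)%C Lf)).
apply: L2norm_le => //; first exact: (L2_cmeas (L2Z (C%:C)%C Lf)).
move=> x; rewrite !normcM ler_wpM2r ?normc_ge0//.
by rewrite normc_real (le_trans (MC x))// ler_norm.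
Qed.

Lemma multiplier_L2 f : L2 f -> L2 (multiplier M f).
Proof. by move=> Lf; exact/ifourier_L2/L2_symbolM/fourier_L2. Qed.

Lemma fourier_multiplier f : L2 f ->
  aeeq (fourier (multiplier M f)) (fun xi => M xi * fourier f xi).
Proof. by move=> Lf; exact/ifourierK/L2_symbolM/fourier_L2. Qed.

Lemma multiplierB f g : L2 f -> L2 g ->
  aeeq (multiplier M (fun x => f x - g x))
    (fun x => multiplier M f x - multiplier M g x).
Proof.
move=> Lf Lg; apply: fourier_inj; first exact/multiplier_L2/L2B.
  by apply: L2B; exact: multiplier_L2.
apply: aeeq_trans (fourier_multiplier (L2B Lf Lg)) _.
apply: aeeq_sym; apply: aeeq_trans (fourierB (multiplier_L2 Lf) (multiplier_L2 Lg)) _.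
apply: filterS3 (fourier_multiplier Lf) (fourier_multiplier Lg) (fourierB Lf Lg).
by move=> x -> -> ->; rewrite mulrBr.
Qed.

Lemma L2norm_multiplier_le (C : R) f : (forall x, normc (M x) <= C) -> L2 f ->
  (L2norm (multiplier M f) <= C%:E * L2norm f)%E.
Proof.
move=> MC Lf; have LFf := fourier_L2 Lf.
have C0 : 0 <= C by apply: le_trans (MC [tuple 0 | i < d]); exact: normc_ge0.
rewrite L2norm_ifourier; last exact: L2_symbolM.
rewrite -(L2norm_fourier Lf) -[C in C%:E](ger0_norm C0) -normc_real.
rewrite -L2normZ; last exact: L2_cmeas.
apply: L2norm_le; [exact/L2_cmeas/L2_symbolM|exact/L2_cmeas/L2Z|] => x.
by rewrite !normcM normc_real ger0_norm// ler_wpM2r ?normc_ge0.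
Qed.

Lemma L2norm_multiplier1 f : (forall x, normc (M x) = 1) -> L2 f ->
  L2norm (multiplier M f) = L2norm f.
Proof.
move=> M1 Lf; rewrite L2norm_ifourier; last exact/L2_symbolM/fourier_L2.
rewrite -(L2norm_fourier Lf) !L2normE; congr (_ `^ _)%E; apply: eq_integral => x _.
by rewrite normcM M1 mul1r.
Qed.

Lemma multiplier_aeeq f g : L2 f -> L2 g -> aeeq f g ->
  aeeq (multiplier M f) (multiplier M g).
Proof.
move=> Lf Lg fg; apply: fourier_inj; [exact: multiplier_L2..|].
apply: aeeq_trans (fourier_multiplier Lf) _; apply: aeeq_sym.
apply: aeeq_trans (fourier_multiplier Lg) _.
by apply: filterS (fourier_aeeq Lf Lg fg) => x ->.
Qed.

End bounded_symbol.

Lemma multiplier_comp M M' f : bounded_symbol M -> bounded_symbol M' -> L2 f ->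
  aeeq (multiplier M (multiplier M' f)) (multiplier (fun x => M x * M' x) f).
Proof.
move=> bM bM' Lf.
have bMM' : bounded_symbol (fun x => M x * M' x).
  case: bM bM' => mM [C MC] [mM' [C' MC']]; split; first exact: cmeasM.
  exists (C * C') => x; rewrite normcM.
  by rewrite ler_pM ?normc_ge0.
apply: fourier_inj; [exact/multiplier_L2/multiplier_L2|exact: multiplier_L2|].
apply: aeeq_trans (fourier_multiplier bM (multiplier_L2 bM' Lf)) _.
apply: aeeq_sym; apply: aeeq_trans (fourier_multiplier bMM' Lf) _.
by apply: filterS (fourier_multiplier bM' Lf) => x ->; rewrite mulrA.
Qed.

Lemma multiplier1 M f : (forall x, M x = 1) -> L2 f -> aeeq (multiplier M f) f.
Proof.
move=> M1 Lf; rewrite /multiplier (_ : (fun xi => _) = fourier f); last first.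
  by apply/funext => x; rewrite M1 mul1r.
exact: fourierK.
Qed.

Lemma bounded_symbol_conj M : bounded_symbol M -> bounded_symbol (fconj M).
Proof.
case=> mM [C MC]; split; first exact: cmeas_conj.
by exists C => x; rewrite /fconj normc_conj.
Qed.

(** The frequency map of [conj_symmetric] preserves the Euclidean norm, so it
    disappears from a radial symbol. *)
Lemma multiplier_conj (m : R -> R[i]) f :
  bounded_symbol (fun x => m (enorm x)) -> L2 f ->
  aeeq (multiplier (fun x => ((m (enorm x))^*)%C) (fconj f))
       (fconj (multiplier (fun x => m (enorm x)) f)).
Proof.
move=> bM Lf; have [_ [rho [rho_ae rhoE Fconj]]] := fourier_pair_spec.
have bMc := bounded_symbol_conj bM.
have Lm := multiplier_L2 bM Lf.
apply: fourier_inj; [exact/(multiplier_L2 bMc)/L2_conj|exact: L2_conj|].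
apply: aeeq_trans (fourier_multiplier bMc (L2_conj Lf)) _.
apply: aeeq_sym; apply: aeeq_trans (Fconj _ Lm) _.
have := rho_ae _ _ (aeeq_conj (fourier_multiplier bM Lf)).
apply: filterS2 (Fconj _ Lf) => x /= Ex ->.
by rewrite -[fourier (fconj f) x]/(fourier_pair.1 (fconj f) x) Ex /= /fconj cconjM rhoE.
Qed.

End Multipliers.
(** * The free evolution and the frequency projections *)

Section Symbols.
Context {R : realType} {d : nat}.
Local Notation Rd := (d.-tuple (measurableTypeR R)).
Local Notation fct := (Rd -> R[i]).
Local Notation leb := (lebesgue_tuple d).
Implicit Types (f g : fct) (t : R).

Lemma measurable_enorm : measurable_fun setT (@enorm R d).
Proof.
apply: (measurableT_comp (continuous_measurable_fun (@sqrt_continuous R))).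
by apply: measurable_sum => i; apply: measurable_funM; exact: measurable_tnth.
Qed.

Definition free_symbol t : fct := fun xi => cis (- (t * enorm xi ^+ 2)).

Lemma free_symbolP t : bounded_symbol (free_symbol t).
Proof.
have mp : measurable_fun setT (fun x : Rd => - (t * enorm x ^+ 2)).
  apply: measurable_funN; apply: measurable_funM => //.
  by apply: measurable_funX; exact: measurable_enorm.
split; last by exists 1 => x; rewrite (normc_cis (- (t * enorm x ^+ 2))).
split.
  by apply: (measurableT_comp (continuous_measurable_fun (@continuous_cos R))).
by apply: (measurableT_comp (continuous_measurable_fun (@continuous_sin R))).
Qed.

Lemma schrodinger_L2 t f : L2 f -> L2 (schrodinger t f).
Proof. exact: (multiplier_L2 (free_symbolP t)). Qed.

Lemma L2norm_schrodinger t f : L2 f -> L2norm (schrodinger t f) = L2norm f.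
Proof.
by move=> Lf; apply: (L2norm_multiplier1 (free_symbolP t)) => // x;
  exact: normc_cis.
Qed.

Lemma schrodingerB t f g : L2 f -> L2 g ->
  aeeq (schrodinger t (fun x => f x - g x))
    (fun x => schrodinger t f x - schrodinger t g x).
Proof. exact: (multiplierB (free_symbolP t)). Qed.

Lemma schrodingerNK t f : L2 f -> aeeq (schrodinger t (schrodinger (- t) f)) f.
Proof.
move=> Lf; apply: aeeq_trans (multiplier_comp (free_symbolP t) (free_symbolP (- t)) Lf) _.
apply: multiplier1 => // x; rewrite /free_symbol /cis mulNr opprK.
set a := t * _; rewrite cosN sinN; apply/eqP; rewrite eq_complex/=.
apply/andP; split; apply/eqP; rewrite mulNr.
  by rewrite opprK -!expr2 cos2Dsin2.
by rewrite [X in X - _]mulrC subrr.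
Qed.

Lemma schrodinger_conj t f : L2 f ->
  aeeq (schrodinger t (fconj f)) (fconj (schrodinger (- t) f)).
Proof.
move=> Lf.
have := @multiplier_conj _ _ (fun r => cis (- (- t * r ^+ 2))) f (free_symbolP _) Lf.
rewrite (_ : (fun x => _) = free_symbol t)//; apply/funext => x.
by rewrite /free_symbol /cis mulNr opprK cosN sinN.
Qed.

Section cutoff.
Variables (chi : R -> R) (hchi : is_cutoff chi).

Lemma cutoff_continuous : continuous chi.
Proof.
move=> x; case: hchi => /(_ 0%N x) dx _ _ _ _.
by apply: differentiable_continuous; apply/derivable1_diffP.
Qed.

Lemma cutoff_bounded : exists C, forall x, `|chi x| <= C.
Proof.
have [K [_ hK]] : bounded_set (chi @` `[-2, 2]).
  apply: compact_bounded; apply: continuous_compact; last exact: segment_compact.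
  exact/continuous_subspaceT/cutoff_continuous.
exists (`|K| + 1) => x.
have [xin|xn] := boolP (x \in `[-2, 2]).
  apply: (hK (`|K| + 1)); last by exists x.
  by rewrite (le_lt_trans (ler_norm K))// ltrDl.
 have -> : chi x = 0; last by rewrite normr0 addr_ge0.
apply/eqP; apply: contraNT xn => cx.
case: hchi => _ + _ _ _ => /(_ x (@subset_closure _ [set t | chi t != 0] x cx)) /=.
by rewrite !in_itv/= => /andP[/ltW -> /ltW ->].
Qed.

Definition LP_symbol n : fct := fun xi =>
  ((psi chi ((dyadic n)^-1 * enorm xi))%:C)%C.

Lemma LP_symbol_bounded n : exists C, forall x, normc (LP_symbol n x) <= C.
Proof.
have [C hC] := cutoff_bounded; exists (C + C) => x.
by rewrite normc_real /psi (le_trans (ler_normB _ _))// lerD.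
Qed.

Lemma LP_symbolP n : bounded_symbol (LP_symbol n).
Proof.
split; last exact: LP_symbol_bounded.
have mchi := continuous_measurable_fun cutoff_continuous.
have mE : measurable_fun setT (fun x : Rd => (dyadic n)^-1 * enorm x : R).
  by apply: measurable_funM => //; exact: measurable_enorm.
split; last exact: measurable_cst.
apply: measurable_funB; first exact: (measurableT_comp mchi).
by apply: (measurableT_comp mchi); exact: measurable_funM.
Qed.

Lemma LP_L2 n f : L2 f -> L2 (LP chi n f).
Proof. exact: (multiplier_L2 (LP_symbolP n)). Qed.

Lemma L2norm_LP_le n : exists C : R, 0 <= C /\
  forall f, L2 f -> (L2norm (LP chi n f) <= C%:E * L2norm f)%E.
Proof.
have [C hC] := LP_symbol_bounded n; exists C; split.
  by apply: le_trans (hC [tuple 0 | i < d]); exact: normc_ge0.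
by move=> f; exact: (L2norm_multiplier_le (LP_symbolP n)).
Qed.

Lemma LPB n f g : L2 f -> L2 g ->
  aeeq (LP chi n (fun x => f x - g x)) (fun x => LP chi n f x - LP chi n g x).
Proof. exact: (multiplierB (LP_symbolP n)). Qed.

Lemma LP_aeeq n f g : L2 f -> L2 g -> aeeq f g -> aeeq (LP chi n f) (LP chi n g).
Proof. exact: (multiplier_aeeq (LP_symbolP n)). Qed.

Lemma LP_schrodinger n t f : L2 f ->
  aeeq (LP chi n (schrodinger t f)) (schrodinger t (LP chi n f)).
Proof.
move=> Lf; apply: aeeq_trans (multiplier_comp (LP_symbolP n) (free_symbolP t) Lf) _.
apply: aeeq_sym; apply: aeeq_trans (multiplier_comp (free_symbolP t) (LP_symbolP n) Lf) _.
rewrite (_ : (fun x => _) = (fun x => LP_symbol n x * free_symbol t x)).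
  exact: aeeq_refl.
by apply/funext => x; rewrite mulrC.
Qed.

Lemma L2norm_LP_conj n f : L2 f -> L2norm (LP chi n (fconj f)) = L2norm (LP chi n f).
Proof.
move=> Lf; rewrite -[RHS]L2norm_conj; apply: L2norm_aeeq.
- exact/L2_cmeas/LP_L2/L2_conj.
- exact/cmeas_conj/L2_cmeas/LP_L2.
have := @multiplier_conj _ _ (fun r => ((psi chi ((dyadic n)^-1 * r))%:C)%C) f
  (LP_symbolP _) Lf.
rewrite (_ : (fun x => _) = LP_symbol n)//; apply/funext => x.
by rewrite conjc_real.
Qed.

End cutoff.
End Symbols.
(** * Behaviour of U^2 functions at infinity *)

Section U2.
Context {R : realType} {d : nat}.
Local Notation Rd := (d.-tuple (measurableTypeR R)).
Local Notation fct := (Rd -> R[i]).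
Local Notation leb := (lebesgue_tuple d).
Implicit Types (f g : fct) (u a : R -> fct) (lam : nat -> R[i]).

(** The steps of an atom are disjoint in time, so at most one of them is active. *)
Lemma U_atom_L2 a t : U_atom 2 a -> L2 (a t) /\ (L2norm (a t) <= 1)%E.
Proof.
case=> K [tk [phi [t0 tlt Lphi sum1 aE]]].
pose I k := ((tk k <= t%:E) && (t%:E < tk k.+1))%E.
have [[k kK Ik]|noI] := pselect (exists2 k, (k < K)%N & I k); last first.
  have -> : a t = fun=> 0.
    apply/funext => x; rewrite aE big1// => k _; case: ifPn => // Ik.
    by case: noI; exists k.
  by rewrite L2norm_cst0; split => //; apply: L2I; [exact: cmeas_cst|rewrite L2norm_cst0].
have tmono i j : (i <= j)%N -> (j <= K)%N -> (tk i <= tk j)%E.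
  elim: j => [|j IH]; first by rewrite leqn0 => /eqP ->.
  rewrite leq_eqVlt => /predU1P[->//|]; rewrite ltnS => ij jK.
  by apply: le_trans (IH ij (ltnW jK)) _; exact/ltW/tlt.
have -> : a t = phi k.
  apply/funext => x; rewrite aE (bigD1 (Ordinal kK))//= -/(I k) Ik big1 ?addr0// => j jk.
  rewrite -/(I j); case: ifPn => // /andP[tj tj1].
  have {}jk : (j : nat) != k by [].
  case/andP: Ik => ik ik1; move: jk; rewrite neq_ltn => /orP[jk|kj].
    by have := lt_le_trans tj1 (le_trans (tmono _ _ jk (ltnW kK)) ik); rewrite ltxx.
  have := lt_le_trans ik1 (le_trans (tmono _ _ kj (ltnW (ltn_ord j))) tj).
  by rewrite ltxx.
split; first exact: Lphi.
have : ((L2norm (phi k)) `^ 2 <= 1)%E.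
  rewrite -sum1 (bigD1 (Ordinal kK))//= leeDl//.
  by apply: sume_ge0 => j _; exact: poweR_ge0.
by rewrite -sqre_poweR ?L2norm_ge0// -[leRHS]mule1 -expe2 le_sqre ?L2norm_ge0.
Qed.

(** Every end point of a step is eventually passed, except for +oo. *)
Lemma U_atom_eventually (p : R) a : U_atom p a -> exists b, \forall t \near +oo, a t = b.
Proof.
case=> K [tk [phi [t0 tlt Lphi sum1 aE]]].
have lim k : exists c : bool,
    \forall t \near +oo, ((tk k <= t%:E) && (t%:E < tk k.+1))%E = c.
  have [c1 h1] : exists c : bool, \forall t \near +oo, (tk k <= t%:E)%E = c.
    case: (tk k) => [r||].
    - exists true; near=> t; rewrite lee_fin; near: t.
      by apply: nbhs_pinfty_ge; exact: num_real.
    - by exists false; near=> t; apply/negbTE; rewrite -ltNge ltry.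
    - by exists true; near=> t; rewrite leNye.
  have [c2 h2] : exists c : bool, \forall t \near +oo, (t%:E < tk k.+1)%E = c.
    case: (tk k.+1) => [r||].
    - exists false; near=> t; rewrite lte_fin; apply/negbTE; rewrite -leNgt.
      by near: t; apply: nbhs_pinfty_ge; exact: num_real.
    - by exists true; near=> t; rewrite ltry.
    - by exists false; near=> t; rewrite ltNge leNye.
  by exists (c1 && c2); apply: filterS2 h1 h2 => t -> ->.
have [c hc] := choice lim.
exists (fun x => \sum_(k < K) if c k then phi k x else 0).
have : \forall t \near +oo, forall k : 'I_K,
    ((tk k <= t%:E) && (t%:E < tk k.+1))%E = c k.
  by apply: filter_forall => k; exact: hc.
apply: filterS => t h; apply/funext => x; rewrite aE.
by apply: eq_bigr => k _; rewrite h.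
Unshelve. all: by end_near. Qed.

Section rep.
Variables (u : R -> fct) (lam : nat -> R[i]) (a : nat -> R -> fct).
Hypotheses (Lu : forall t, L2 (u t)) (ua : U_rep 2 u lam a).
Let c j : R := normc (lam j).
Let b t j : fct := fun x => lam j * a j t x.

Let mb t j : cmeas (b t j).
Proof.
case: ua => /(_ j) /(U_atom_L2 t)[/L2_cmeas ma _] _ _.
by apply: cmeasM => //; exact: cmeas_cst.
Qed.

Let bc t j : (L2norm (b t j) <= (c j)%:E)%E.
Proof.
case: ua => /(_ j) /(U_atom_L2 t)[/L2_cmeas ma a1] _ _.
by rewrite L2normZ// -[leRHS]mule1 lee_wpmul2l// lee_fin normc_ge0.
Qed.

Let msum t (s : seq nat) : cmeas (fun x => \sum_(j <- s) b t j x).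
Proof. exact: cmeas_sum. Qed.

(** A later partial sum is within the sum of the remaining coefficients, and the
    partial sums tend to u. *)
Lemma U_rep_tail t n :
  (L2norm (fun x => u t x - \sum_(j < n) lam j * a j t x)%R
    <= \sum_(n <= j <oo) (normc (lam j))%:E)%E.
Proof.
have c0 j : (0 <= (c j)%:E)%E by rewrite lee_fin normc_ge0.
apply/lee_addgt0Pr => e e0.
have [_ _ /(_ t) /(cvge0P _).1 h] := ua.
have {}h := h (fun n => L2norm_ge0 _) e e0.
near \oo => m.
have nm : (n <= m)%N by near: m; exact: nbhs_infty_ge.
have h2 : (L2norm (fun x => u t x - \sum_(0 <= j < m) b t j x)%R <= e%:E)%E.
  by under eq_fun do rewrite big_mkord; near: m; exact: h.
rewrite (_ : (fun x => _) = (fun x => \sum_(n <= j < m) b t j x +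
    (u t x - \sum_(0 <= j < m) b t j x))).
  apply: le_trans (L2normD _ _) _.
  - exact: msum.
  - by apply: cmeasB; [exact: L2_cmeas|exact: msum].
  apply: leeD => //; apply: le_trans (L2norm_sum _ (mb t)) _.
  apply: (@le_trans _ _ (\sum_(n <= j < m) (c j)%:E)%E); first exact: lee_sum.
  exact: nneseries_lim_ge.
apply/funext => x; rewrite (@big_cat_nat _ _ _ n 0 m)//=.
rewrite -(big_mkord xpredT (fun j => lam j * a j t x)).
by rewrite opprD !addrA [in RHS]addrC !addrA [- _ + _]addrC subrr add0r addrC.
Unshelve. all: by end_near. Qed.

Lemma U_rep_sup t : (L2norm (u t) <= \sum_(0 <= j <oo) (normc (lam j))%:E)%E.
Proof.
have := U_rep_tail t 0; congr (_ <= _)%E.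
by congr L2norm; apply/funext => x; rewrite big_ord0 subr0.
Qed.

(** The limit is the sum of the final values of the atoms.  For t so large that
    the first n atoms are constant, u t and this limit differ by two remainders
    of the series. *)
Lemma U_rep_limit : exists g, L2 g /\
  L2norm (fun x => u t x - g x) @[t --> +oo] --> 0%E.
Proof.
have [atoms coo _] := ua.
have [fin finE] := choice (fun j => U_atom_eventually (atoms j)).
pose B j : fct := fun x => lam j * fin j x.
have Bb j : \forall t \near +oo, b t j = B j.
  by apply: filterS (finE j) => t h; rewrite /b h.
have mB j : cmeas (B j).
  near (pinfty_nbhs R) => t.
  have <- : b t j = B j by near: t; exact: Bb.
  exact: mb.
have Bc j : (L2norm (B j) <= (c j)%:E)%E.
  near (pinfty_nbhs R) => t.
  have <- : b t j = B j by near: t; exact: Bb.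
  exact: bc.
have [g [Lg gB]] := L2_series mB Bc coo.
exists g; split => //; apply/cvge0P => [t|e e0]; first exact: L2norm_ge0.
have c0 j : (0 <= (c j)%:E)%E by rewrite lee_fin normc_ge0.
have tail0 := nneseries_tail_cvg coo (fun j _ => c0 j).
have e20 : 0 < e / 2 by rewrite divr_gt0.
have [n _ /(_ n (leqnn n))/= hn] :
    \forall n \near \oo, (\sum_(n <= j <oo) (c j)%:E <= (e / 2)%:E)%E.
  apply: (cvge0P _).1 tail0 _ e20 => n.
  by apply: nneseries_ge0 => j _ _; rewrite lee_fin normc_ge0.
have : \forall t \near +oo, forall j : 'I_n, b t j = B j.
  by apply: filter_forall => j; exact: Bb.
apply: filterS => t h.
rewrite (_ : (fun x => _) = (fun x => (u t x - \sum_(j < n) lam j * a j t x)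
   - (g x - \sum_(j < n) B j x))); last first.
  apply/funext => x; rewrite (eq_bigr (fun j : 'I_n => B j x)).
    by rewrite opprB addrA subrK.
  by move=> j _; rewrite -h.
have mS (F : nat -> fct) : (forall j, cmeas (F j)) ->
    cmeas (fun x => \sum_(j < n) F j x).
  move=> mF; under eq_fun do rewrite -(big_mkord xpredT (fun j => F j _)).
  exact: cmeas_sum.
apply: le_trans (L2normB _ _) _.
- by apply: cmeasB; [exact: L2_cmeas|exact: (mS (b t))].
- by apply: cmeasB; [exact: L2_cmeas|exact: mS].
rewrite [e]splitr EFinD; apply: leeD; first exact: le_trans (U_rep_tail t n) hn.
exact: le_trans (gB n) hn.
Unshelve. all: by end_near. Qed.

End rep.

Lemma L2norm_le_U_norm u t : (forall t, L2 (u t)) -> (L2norm (u t) <= U_norm 2 u)%E.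
Proof.
move=> Lu; apply: le_ereal_inf_tmp => _ [lam [a [ua ->]]].
exact: (U_rep_sup Lu ua).
Qed.

Lemma U_space_limit u : U_space 2 u -> exists g, L2 g /\
  L2norm (fun x => u t x - g x) @[t --> +oo] --> 0%E.
Proof. by case=> Lu [lam [a ua]]; exact: (U_rep_limit Lu ua). Qed.

End U2.
(** * Dominated convergence for sums *)

Section DominatedSums.
Context {R : realType} {T : Type} (F : set_system T) {FF : Filter F}.
Context {I : choiceType}.
Variables (f : T -> I -> \bar R) (a : I -> \bar R).
Hypothesis f0 : forall t i, (0 <= f t i)%E.
Hypothesis f_cvg0 : forall i, f ^~ i @ F --> 0%E.

Lemma cvg0_sum (s : seq I) : (\sum_(i <- s) f t i)%E @[t --> F] --> 0%E.
Proof.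
elim: s => [|i s IH]; first by under eq_fun do rewrite big_nil; exact: cvg_cst.
have s0 (r : seq I) t : (0 <= \sum_(i <- r) f t i)%E by apply: sume_ge0.
apply/cvge0P => // e e0; have e20 : 0 < e / 2 by rewrite divr_gt0.
have h1 := (@cvge0P _ _ _ FF _ (fun t => f0 t i)).1 (f_cvg0 i) _ e20.
have h2 := (@cvge0P _ _ _ FF _ (s0 s)).1 IH _ e20.
apply: filterS2 h1 h2 => t h1 h2.
by rewrite big_cons [e]splitr EFinD leeD.
Qed.

(** Outside a large finite set X the dominating sum is at most e/2, and on X the
    sum tends to 0. *)
Lemma esum_dominated_cvg0 : (forall i, 0 <= a i)%E ->
  (\forall t \near F, forall i, (f t i <= a i)%E) ->
  (\esum_(i in setT) a i < +oo)%E ->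
  (\esum_(i in setT) f t i)%E @[t --> F] --> 0%E.
Proof.
move=> a0 fa aoo; apply/cvge0P => [t|e e0]; first by apply: esum_ge0.
have e20 : 0 < e / 2 by rewrite divr_gt0.
set S := (\esum_(i in setT) a i)%E in aoo.
have S0 : (0 <= S)%E by apply: esum_ge0.
have Sfin : S \is a fin_num by rewrite ge0_fin_numE.
have : (S - (e / 2)%:E < S)%E by rewrite -(fineK Sfin) -EFinB lte_fin ltrBlDr ltrDl.
move=> /ereal_sup_gt[_ [X [finX _] <-] SX].
pose Xs := finmap.enum_fset (fset_set X).
have split_sum (g : I -> \bar R) : (forall i, 0 <= g i)%E -> (\esum_(i in setT) g i =
    \sum_(i <- Xs) g i + \esum_(i in ~` X) g i)%E.
  move=> g0; rewrite (esumID X)// !setTI esum_fset//.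
  by rewrite fsbig_finite.
have tail : (\esum_(i in ~` X) a i <= (e / 2)%:E)%E.
  move: SX; rewrite fsbig_finite// -/S -/Xs.
  have tail0 : (0 <= \esum_(i in ~` X) a i)%E by apply: esum_ge0.
  have X0 : (0 <= \sum_(i <- Xs) a i)%E by apply: sume_ge0.
  have := split_sum _ a0; rewrite -/S; move: tail0 X0 Sfin.
  case: (\esum_(i in ~` X) a i)%E => [t||]//;
    case: (\sum_(i <- Xs) a i)%E => [x||]//;
    case: S {aoo S0} => [r||]// _ _ _ [].
  by rewrite -EFinB lte_fin lee_fin => -> ?; lra.
have X0 t : (0 <= \sum_(i <- Xs) f t i)%E by apply: sume_ge0.
have h := (@cvge0P _ _ _ FF _ X0).1 (cvg0_sum _) _ e20.
apply: filterS2 fa h => t fa h; rewrite split_sum// [e]splitr EFinD leeD//.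
by apply: le_trans tail; apply: le_esum.
Qed.

End DominatedSums.

(** * Scattering in Sobolev norms *)

Section Sobolev.
Context {R : realType} {d : nat}.
Local Notation Rd := (d.-tuple (measurableTypeR R)).
Local Notation fct := (Rd -> R[i]).
Local Notation leb := (lebesgue_tuple d).
Variables (chi : R -> R) (hchi : is_cutoff chi).
Implicit Types (f g : fct) (s : R).

Let term s (f : fct) (n : int) : \bar R :=
  (((dyadic n) `^ (2 * s))%:E * L2norm (LP chi n f) ^+ 2)%E.

Lemma Hdot_norm_aeeq s f g : L2 f -> L2 g -> aeeq f g ->
  Hdot_norm chi s f = Hdot_norm chi s g.
Proof.
move=> Lf Lg fg; congr (_ `^ _)%E; apply: eq_esum => n _.
congr (_ * _ ^+ 2)%E; apply: L2norm_aeeq; [exact/L2_cmeas/LP_L2..|].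
exact: LP_aeeq.
Qed.

Lemma H_norm_aeeq s f g : L2 f -> L2 g -> aeeq f g ->
  H_norm chi s f = H_norm chi s g.
Proof. by move=> Lf Lg fg; rewrite /H_norm !(Hdot_norm_aeeq _ Lf Lg). Qed.

Lemma Hdot_norm_conj s f : L2 f -> Hdot_norm chi s (fconj f) = Hdot_norm chi s f.
Proof.
move=> Lf; congr (_ `^ _)%E; apply: eq_esum => n _.
by rewrite L2norm_LP_conj.
Qed.

Lemma H_norm_conj s f : L2 f -> H_norm chi s (fconj f) = H_norm chi s f.
Proof. by move=> Lf; rewrite /H_norm !Hdot_norm_conj. Qed.

Lemma Hdot_norm_ge0 s f : (0 <= Hdot_norm chi s f)%E.
Proof. exact: poweR_ge0. Qed.

Lemma Hdot_norm_cvg0 s (F : set_system R) {FF : Filter F} (w : R -> fct) :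
  (\esum_(n in setT) term s (w t) n)%E @[t --> F] --> 0%E ->
  Hdot_norm chi s (w t) @[t --> F] --> 0%E.
Proof.
have t0 f n : (0 <= term s f n)%E.
  by rewrite mule_ge0 ?lee_fin ?powR_ge0 ?expe_ge0 ?L2norm_ge0.
have s0 t : (0 <= \esum_(n in setT) term s (w t) n)%E by apply: esum_ge0.
move=> /(@cvge0P _ _ _ FF _ s0) h; apply/cvge0P => [t|e e0]; first exact: Hdot_norm_ge0.
have e20 : 0 < e ^+ 2 by rewrite exprn_gt0.
apply: filterS (h _ e20) => t ht; rewrite -le_sqre ?Hdot_norm_ge0 ?lee_fin ?(ltW e0)//.
rewrite sqre_poweR ?Hdot_norm_ge0// /Hdot_norm -poweRrM mulVf// poweRe1//.
exact: s0.
Qed.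

Section linear_scattering.
Variables (v : R -> fct) (up : fct).
Hypotheses (Lv : forall t, L2 (v t)) (Lup : L2 up).
Hypothesis vup : L2norm (fun x => free_pullback v t x - up x) @[t --> +oo] --> 0%E.

Let A n := UD_norm 2 (fun t => LP chi n (v t)).
Let D t : fct := fun x => v t x - schrodinger t up x.

Let LD t : L2 (D t).
Proof. by apply: L2B => //; exact: schrodinger_L2. Qed.

Let LP_v n t : (L2norm (LP chi n (v t)) <= A n)%E.
Proof.
rewrite -(L2norm_schrodinger (- t)); last exact: LP_L2.
apply: (L2norm_le_U_norm (u := free_pullback (fun t => LP chi n (v t)))) => t'.
exact/schrodinger_L2/LP_L2.
Qed.

Let DE t : L2norm (D t) = L2norm (fun x => free_pullback v t x - up x).
Proof.
rewrite -(L2norm_schrodinger (- t) (LD t)); apply: L2norm_aeeq.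
- exact/L2_cmeas/schrodinger_L2.
- by apply: cmeasB; apply: L2_cmeas => //; exact: schrodinger_L2.
apply: aeeq_trans (schrodingerB _ (Lv t) (schrodinger_L2 t Lup)) _.
by have := schrodingerNK (- t) Lup; rewrite opprK; apply: filterS => x ->.
Qed.

Let LP_D n : L2norm (LP chi n (D t)) @[t --> +oo] --> 0%E.
Proof.
have [C [C0 hC]] := @L2norm_LP_le R d chi hchi n.
apply/cvge0P => [t|e e0]; first exact: L2norm_ge0.
have C1 : 0 < C + 1 by rewrite ltr_wpDl.
have e1 : 0 < e / (C + 1) by rewrite divr_gt0.
apply: filterS ((cvge0P (fun t => L2norm_ge0 _)).1 vup _ e1) => t ht.
apply: le_trans (hC _ (LD t)) _; rewrite DE.
apply: le_trans (lee_wpmul2l _ ht) _; first by rewrite lee_fin.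
rewrite -EFinM lee_fin mulrCA ger_pMr// ler_pdivrMr// mul1r lerDl//.
Qed.

Let LP_up n t : L2norm (LP chi n (schrodinger t up)) = L2norm (LP chi n up).
Proof.
rewrite -(L2norm_schrodinger t (LP_L2 hchi n Lup)); apply: L2norm_aeeq.
- exact/L2_cmeas/LP_L2/schrodinger_L2.
- exact/L2_cmeas/schrodinger_L2/LP_L2.
exact: LP_schrodinger.
Qed.

Let LP_DE n t : aeeq (LP chi n (D t))
  (fun x => LP chi n (v t) x - LP chi n (schrodinger t up) x).
Proof. by apply: LPB => //; exact: schrodinger_L2. Qed.

Let mLv n t : cmeas (LP chi n (v t)). Proof. exact/L2_cmeas/LP_L2. Qed.
Let mLS n t : cmeas (LP chi n (schrodinger t up)).
Proof. exact/L2_cmeas/LP_L2/schrodinger_L2. Qed.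
Let mLD n t : cmeas (LP chi n (D t)). Proof. exact/L2_cmeas/LP_L2. Qed.

(** The bound on [LP chi n (v t)] is uniform in t, so it passes to the limit. *)
Lemma LP_limit_le n : (L2norm (LP chi n up) <= A n)%E.
Proof.
apply/lee_addgt0Pr => e e0.
near (pinfty_nbhs R) => t.
have De : (L2norm (LP chi n (D t)) <= e%:E)%E.
  by near: t; apply: (cvge0P _).1 (LP_D n) _ e0 => t; exact: L2norm_ge0.
rewrite -(LP_up n t) (@L2norm_aeeq _ _ _
  (fun x => LP chi n (v t) x - LP chi n (D t) x))//.
- by apply: le_trans (L2normB _ _) _ => //; exact: leeD.
- exact: cmeasB.
- by apply: filterS (LP_DE n t) => x ->; rewrite opprB addrCA subrr addr0.
Unshelve. all: by end_near. Qed.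

Let LP_D_le n t : (L2norm (LP chi n (D t)) <= A n + A n)%E.
Proof.
rewrite (L2norm_aeeq (mLD n t) (cmeasB (mLv n t) (mLS n t)) (LP_DE n t)).
apply: le_trans (L2normB _ _) _ => //; apply: leeD; first exact: LP_v.
by rewrite LP_up; exact: LP_limit_le.
Qed.

Variable s : R.
Hypothesis vZ : (Zdot_norm chi s v < +oo)%E.

Let A0 n : (0 <= A n)%E. Proof. exact: le_trans (L2norm_ge0 _) (LP_v n 0). Qed.

Let w n : \bar R := ((dyadic n) `^ (2 * s))%:E.
Let w0 n : (0 <= w n)%E. Proof. by rewrite lee_fin powR_ge0. Qed.

Let sumA : (\esum_(n in setT) (w n * A n ^+ 2) < +oo)%E.
Proof. by apply: (@lty_poweRy _ _ 2^-1) => //; rewrite invr_neq0. Qed.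

Lemma Hdot_limit_lty : (Hdot_norm chi s up < +oo)%E.
Proof.
apply: poweR_lty; apply: le_lt_trans sumA; apply: le_esum => n _.
apply: lee_wpmul2l; first exact: w0.
by rewrite le_sqre ?L2norm_ge0//; exact: LP_limit_le.
Qed.

(** Each frequency block of the difference tends to 0 and is dominated by
    [A n + A n], one summand for v and one for the free solution. *)
Lemma Hdot_scattering : Hdot_norm chi s (D t) @[t --> +oo] --> 0%E.
Proof.
apply: Hdot_norm_cvg0.
apply: (@esum_dominated_cvg0 _ _ _ _ _ _ (fun n => w n * (A n + A n) ^+ 2)%E).
- by move=> t n; rewrite mule_ge0 ?lee_fin ?powR_ge0 ?expe_ge0 ?L2norm_ge0.
- move=> n; rewrite -[X in _ --> X](mule0 (w n)); apply: cvgeZl => //.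
  rewrite -[X in _ --> X](mule0 0%E); under eq_fun do rewrite expe2.
  exact: cvgeM.
- by move=> n; rewrite mule_ge0 ?expe_ge0 ?adde_ge0.
- apply: nearW => t n; apply: lee_wpmul2l; first exact: w0.
  by rewrite le_sqre ?L2norm_ge0 ?adde_ge0.
have -> : (\esum_(n in setT) (w n * (A n + A n) ^+ 2) =
    \esum_(n in setT) ((w n * A n ^+ 2 + w n * A n ^+ 2) +
                       (w n * A n ^+ 2 + w n * A n ^+ 2)))%E.
  apply: eq_esum => n _; rewrite !expe2.
  by rewrite ge0_muleDl ?adde_ge0// ge0_muleDr// !ge0_muleDr ?adde_ge0 ?mule_ge0.
have p n : (0 <= w n * A n ^+ 2)%E by rewrite mule_ge0 ?expe_ge0.
by rewrite !esumD ?lte_add_pinfty// => n _; rewrite ?adde_ge0.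
Qed.

End linear_scattering.
End Sobolev.
(** * Scattering of the flow maps *)

Section Scattering.
Context {R : realType} {d : nat}.
Local Notation Rd := (d.-tuple (measurableTypeR R)).
Local Notation fct := (Rd -> R[i]).
Variables (chi : R -> R) (hchi : is_cutoff chi).

Lemma Zdot_scatters s (v : R -> fct) :
  Z_space (Hdot_norm chi s) (Zdot_norm chi s) v -> scatters (Hdot_norm chi s) v +oo.
Proof.
case=> -[Hv _] /U_space_limit[up [Lup vup]] vZ.
have Lv t : L2 (v t) by case: (Hv t I).
exists up; split; last exact: Hdot_scattering.
by split => //; exact: (Hdot_limit_lty hchi Lv Lup vup).
Qed.

Lemma Z_scatters s (v : R -> fct) :
  Z_space (H_norm chi s) (Z_norm chi s) v -> scatters (H_norm chi s) v +oo.
Proof.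
case=> -[Hv _] /U_space_limit[up [Lup vup]] vZ.
have Lv t : L2 (v t) by case: (Hv t I).
have [vZ0 vZs] : (Zdot_norm chi 0 v < +oo /\ Zdot_norm chi s v < +oo)%E.
  by split; apply: le_lt_trans vZ; rewrite (leeDl, leeDr)// poweR_ge0.
exists up; split.
  split => //; rewrite /H_norm; apply: lte_add_pinfty;
    exact: (Hdot_limit_lty hchi Lv Lup vup).
by rewrite -[0%E]adde0; apply: cvgeD => //; exact: Hdot_scattering.
Qed.

(** The homogeneous and the inhomogeneous case use the same argument, for a norm
    that is invariant under conjugation and under a.e. equality. *)
Section flow.
Variables (hn : fct -> \bar R) (zn : (R -> fct) -> \bar R).
Hypothesis hn_conj : forall f, L2 f -> hn (fconj f) = hn f.
Hypothesis hn_aeeq : forall f g, L2 f -> L2 g -> aeeq f g -> hn f = hn g.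
Hypothesis Z_scat : forall v, Z_space hn zn v -> scatters hn v +oo.
Variables (m : nat) (k : 'I_d) (r : R) (S : fct -> R -> fct).
Hypothesis wpS : well_posed m k hn zn r S.

Lemma flow_L2 u0 t : H_ball hn r u0 -> 0 <= t -> L2 (S u0 t).
Proof.
move=> u0B t0; case: wpS => /(_ _ u0B)[[[[HS _] _] _] _ _] _.
by case: (HS t); rewrite /half_line/= ?in_itv/= ?t0.
Qed.

Lemma forward_scatters u0 : H_ball hn r u0 -> scatters hn (S u0) +oo.
Proof.
move=> u0B; case: (wpS) => /(_ _ u0B)[[[_ [v [vZ vS]]] _] _ _] _.
have Lv t : L2 (v t) by case: vZ => -[/(_ t I)[]].
have [up [upH vup]] := Z_scat vZ.
exists up; split => //; apply: cvg_trans vup; apply: near_eq_cvg.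
near=> t; have t0 : 0 <= t by near: t; apply: nbhs_pinfty_ge; exact: num_real.
have Lup : L2 (schrodinger t up) by case: upH => + _; exact: schrodinger_L2.
apply: hn_aeeq; [exact: L2B|by apply: L2B => //; exact: flow_L2|].
have /vS : half_line t by rewrite /half_line/= in_itv/= t0.
by apply: filterS => x ->.
Unshelve. all: by end_near. Qed.

(** Time reversal: the conjugate of the free solution with datum up is the free
    solution with datum conj up, run backwards. *)
Lemma backward_scatters u0 : H_ball hn r u0 -> scatters hn (backward S u0) -oo.
Proof.
move=> [[Lu0 u0H] u0r].
have u0B : H_ball hn r (fconj u0).
  by split; rewrite ?hn_conj//; split; [exact: L2_conj|rewrite hn_conj].
have [up [[Lup upH] Sup]] := forward_scatters u0B.
exists (fconj up); split; first by split; [exact: L2_conj|rewrite hn_conj].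
apply/cvgNy_compNP; apply: cvg_trans Sup; apply: near_eq_cvg.
near=> t; have t0 : 0 <= t by near: t; apply: nbhs_pinfty_ge; exact: num_real.
have LS := flow_L2 u0B t0; have LU := schrodinger_L2 t Lup.
rewrite /= /backward opprK -[LHS]hn_conj; last exact: L2B.
apply: hn_aeeq; first exact/L2_conj/L2B.
  by apply: L2B; [exact: L2_conj|exact/schrodinger_L2/L2_conj].
have := schrodinger_conj (- t) Lup; rewrite opprK.
by apply: filterS => x ->; rewrite /fconj cconjB.
Unshelve. all: by end_near. Qed.

End flow.
End Scattering.

Theorem corollary1p2 (R : realType) (d m : nat) (k : 'I_d) (chi : R -> R)
    (hd : (1 <= d)%N) (hm : (3 <= m)%N) (hchi : is_cutoff chi) :
  let Rd := d.-tuple (measurableTypeR R) in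
  let sc : R := d%:R / 2 - (m%:R - 1)^-1 in
  (forall (r : R) (S : (Rd -> R[i]) -> R -> Rd -> R[i]), 0 < r ->
     well_posed m k (Hdot_norm chi sc) (Zdot_norm chi sc) r S ->
     forall u0 : Rd -> R[i], H_ball (Hdot_norm chi sc) r u0 ->
       scatters (Hdot_norm chi sc) (S u0) +oo%R /\
       scatters (Hdot_norm chi sc) (backward S u0) -oo%R) /\
  (forall s : R, sc <= s ->
   forall (r : R) (S : (Rd -> R[i]) -> R -> Rd -> R[i]), 0 < r ->
     well_posed m k (H_norm chi s) (Z_norm chi s) r S ->
     forall u0 : Rd -> R[i], H_ball (H_norm chi s) r u0 ->
       scatters (H_norm chi s) (S u0) +oo%R /\
       scatters (H_norm chi s) (backward S u0) -oo%R).
Proof.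
move=> Rd sc; split=> [r S _ wp u0 u0B|s _ r S _ wp u0 u0B].
  have hc := @Hdot_norm_conj R d chi hchi sc.
  have ha := @Hdot_norm_aeeq R d chi hchi sc.
  have hZ := @Zdot_scatters R d chi hchi sc.
  by split; [exact: forward_scatters wp _ _|exact: backward_scatters wp _ _].
have hc := @H_norm_conj R d chi hchi s.
have ha := @H_norm_aeeq R d chi hchi s.
have hZ := @Z_scatters R d chi hchi s.
by split; [exact: forward_scatters wp _ _|exact: backward_scatters wp _ _].
Qed.
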